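(* Every rectifiable closed curve $\mathcal{C}\subset\mathbb{S}^2$ of length $L$, simple or not, satisfies $$\mathcal{J}(\mathcal{C})\ \ge\ \frac{\pi}{2}-\frac{L}{2\pi}.$$ For $0<L\le 2\pi$ the circles of length $L$ on $\mathbb{S}^2$ attain equality in this inequality, and no other rectifiable simple closed curve of length $L$ does; consequently $$J(L)=\frac{\pi}{2}-\frac{L}{2\pi},\qquad 0<L\le 2\pi.$$
   Context: $\mathbb{S}^2$ is the unit sphere in $\mathbb{R}^3$ with area element $dA$. The geodesic distance is $\operatorname{dist}(x,y)=\arccos\langle x,y\rangle$, and for a closed curve $\mathcal{C}\subset\mathbb{S}^2$, $\operatorname{dist}(x,\mathcal{C})=\min_{y\in\mathcal{C}}\arccos\langle x,y\rangle$. Define $$\mathcal{J}(\mathcal{C})=\frac{1}{4\pi}\int_{\mathbb{S}^2}\operatorname{dist}(x,\mathcal{C})\,dA(x),$$ and let $J(L)=\inf\mathcal{J}(\mathcal{C})$, the infimum being over all rectifiable simple closed curves $\mathcal{C}\subset\mathbb{S}^2$ of length exactly $L$. A circle on $\mathbb{S}^2$ is a set of the form $\{y\in\mathbb{S}^2:\operatorname{dist}(x,y)=\theta_0\}$ with $x\in\mathbb{S}^2$, $\theta_0\in(0,\pi)$; its length is $2\pi\sin\theta_0$. *)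

(* Defs.v *)
(* Points of R^3 are row vectors 'rV[R]_3; the library norm
   on this type is the max norm, so the Euclidean structure is set up here. *)
From HB Require Import structures.
From mathcomp Require Import all_boot all_order all_algebra.
From mathcomp Require Import all_classical all_reals all_analysis.

Set Implicit Arguments.
Unset Strict Implicit.
Unset Printing Implicit Defensive.

Import Order.TTheory GRing.Theory Num.Theory.
Import numFieldNormedType.Exports.

Local Open Scope classical_set_scope.
Local Open Scope ring_scope.

Definition dot (R : realType) (x y : 'rV[R]_3) : R :=
  \sum_(i < 3) x 0 i * y 0 i.

Definition enorm (R : realType) (x : 'rV[R]_3) : R := Num.sqrt (dot x x).

Definition sphere (R : realType) : set 'rV[R]_3 := [set x | enorm x = 1].

Definition geodist (R : realType) (x y : 'rV[R]_3) : R := acos (dot x y).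

(* For a compact nonempty C, such as a closed curve, this infimum is a
   minimum. *)
Definition dist_to (R : realType) (x : 'rV[R]_3) (C : set 'rV[R]_3) : R :=
  inf [set geodist x y | y in C].

Definition spherical (R : realType) (t p : R) : 'rV[R]_3 :=
  \row_(i < 3) [:: sin p * cos t; sin p * sin t; cos p]`_i.

(* The surface integral of f over the sphere: in longitude t and colatitude p
   the area element is dA = |d_t x d_p| dt dp = sin p dt dp. *)
Definition sphere_integral (R : realType) (f : 'rV[R]_3 -> R) : R :=
  \int[(@lebesgue_measure R \x @lebesgue_measure R)%E]_(tp in
    `[0, 2 * pi]%classic `*` `[0, pi]%classic)
    (f (spherical tp.1 tp.2) * sin tp.2).

Definition mean_dist (R : realType) (C : set 'rV[R]_3) : R :=
  (4 * pi)^-1 * sphere_integral (fun x => dist_to x C).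

(* Curves are parametrized by [0, 1]; the values of g outside [0, 1] are
   irrelevant. *)
Definition closed_curve (R : realType) (g : R -> 'rV[R]_3) : Prop :=
  [/\ {within `[0, 1], continuous g},
      forall t : R, t \in `[0, 1] -> sphere (g t)
    & g 0 = g 1].

Definition simple_closed_curve (R : realType) (g : R -> 'rV[R]_3) : Prop :=
  closed_curve g /\ {in `[0, 1[ &, injective g}.

Definition curve_image (R : realType) (g : R -> 'rV[R]_3) : set 'rV[R]_3 :=
  g @` `[0, 1].

(* Euclidean length of the polygon inscribed in g at a, s_0, s_1, ..; this is
   the library's variation with the Euclidean norm of R^3. *)
Definition polygon_length (R : realType) (a b : R) (g : R -> 'rV[R]_3)
    (s : seq R) : R :=
  let G := g \o nth b (a :: s) in
  \sum_(0 <= n < size s) enorm (G n.+1 - G n).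

(* A curve is rectifiable iff this is finite, so that "rectifiable of length L",
   with L : R, reads curve_length g = L%:E. *)
Definition curve_length (R : realType) (g : R -> 'rV[R]_3) : \bar R :=
  ereal_sup [set (polygon_length 0 1 g s)%:E | s in itv_partition 0 1].

Definition simple_closed_of_length (R : realType) (L : R) :
    set (set 'rV[R]_3) :=
  [set C | exists g, [/\ simple_closed_curve g, curve_length g = L%:E
                       & C = curve_image g]].

Definition inf_mean_dist (R : realType) (L : R) : R :=
  inf [set mean_dist C | C in simple_closed_of_length L].

Definition circle (R : realType) (x : 'rV[R]_3) (theta : R) :
    set 'rV[R]_3 :=
  [set y | sphere y /\ geodist x y = theta].

(* The length of a circle of angular radius theta is 2 pi sin theta. *)
Definition circle_of_length (R : realType) (L : R) : set (set 'rV[R]_3) :=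
  [set C | exists x theta, [/\ sphere x, 0 < theta < pi,
                               2 * pi * sin theta = L & C = circle x theta]].

(* Main.v *)
Require Import Defs.
From HB Require Import structures.
From mathcomp Require Import all_boot all_order all_algebra.
From mathcomp Require Import all_classical all_reals all_analysis.
From mathcomp Require Import measurable_realfun ring lra.

Set Implicit Arguments.
Unset Strict Implicit.
Unset Printing Implicit Defensive.

Import Order.TTheory GRing.Theory Num.Theory.
Import numFieldNormedType.Exports.

Local Open Scope classical_set_scope.
Local Open Scope ring_scope.

(** Fix x on the sphere and follow the spherical distance h t = arccos <x, g t>
    along the curve g. Its minimum is the distance from x to the curve C, and
    since arccos (- u) = pi - arccos u, its maximum is pi minus the distance from
    - x to C. Hence
      dist (x, C) + dist (- x, C) = pi - (max h - min h),
    and because h runs through a closed loop, its oscillation max h - min h is at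
    most half its total variation. When g moves by ds in the direction e, orthogonal
    to g, the function h changes by |cos t| ds, where t is the angle at g between e
    and the direction of x; the mean of |cos t| over x is 2 / pi. So the mean over x
    of the variation of h is 2 L / pi, and averaging the identity above, in which x
    and - x contribute equally, gives mean_dist C >= pi / 2 - L / (2 pi).

    This is carried out on inscribed polygons. The estimate for one edge is
    [arc_bound]. It rests on the rotation invariance of the surface integral,
    [sphere_integral_acos_invariant], which moves an end of the edge to the north
    pole, and on a limit at the pole, [cvg_arc_integral]. Rotation invariance of an
    integral written in longitude and colatitude is not visible: it is derived from
    the fact that the derivative of the integrand along a rotation is a divergence
    in these coordinates, [Rintegral_rotation_field]. The combination of the edges
    is [sphere_integral_dist_to_ge].

    For a circle of angular radius th and centre c the distance is
    |arccos <x, c> - th|, whose integral is explicit ([mean_dist_circle]) and yields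
    equality.

    Conversely, suppose that four times a <= b <= c <= d and a point x are such that
    h is larger at a and c than at b and d. Then the variation of h exceeds twice
    its oscillation by at least twice the gap ([variation_gap]), and this persists for x in an
    open set, so that the inequality is strict. In case of equality, therefore, no
    plane separates g a, g c from g b, g d. Four affinely independent points can be
    separated in any way, so any four points of the curve are coplanar
    ([coplanar4]); the curve lies in a plane, hence on a circle, and a simple closed
    curve on a circle fills it ([curve_fills_circle]). *)

(** * Integrals of continuous functions on rectangles *)

(** R x R has a countable base of boxes with rational centres, so the product
    sigma-algebra contains all open sets. *)
Lemma open_measurable2 (R : realType) (O : set (R * R)) :
  open O -> measurable O.
Proof.
move=> oO.
pose box (q r : rat) (n : nat) : set (R * R) :=
  ball (ratr q : R) n.+1%:R^-1 `*` ball (ratr r : R) n.+1%:R^-1.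
pose B q r n := if `[< box q r n `<=` O >] then box q r n else set0.
have -> : O = \bigcup_q \bigcup_r \bigcup_n B q r n.
  apply/seteqP; split=> [[x y] Oxy|[x y] [q _ [r _ [n _]]]]; last first.
    by rewrite /B; case: asboolP => // sub /sub.
  have /nbhs_ballP[e /= e0 eO] : nbhs (x, y) O by exact: open_nbhs_nbhs.
  have [n ne] : exists n : nat, n.+1%:R^-1 + n.+1%:R^-1 < e :> R.
    exists (Num.truncn (2 / e)); set k : R := _.+1%:R.
    have k0 : 0 < k by rewrite ltr0n.
    have lek : 2 / e < k by exact: truncnS_gt.
    rewrite -mulr2n -mulr_natl ltr_pdivrMr//.
    by rewrite mulrC -ltr_pdivrMr.
  have n0 : (0 : R) < n.+1%:R^-1 by rewrite invr_gt0.
  pose h : R := n.+1%:R^-1; rewrite -/h in ne n0.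
  have [q xq] : exists q, ratr q \in `](x - h), (x + h)[.
    by apply: rat_in_itvoo; lra.
  have [r yr] : exists r, ratr r \in `](y - h), (y + h)[.
    by apply: rat_in_itvoo; lra.
  move: xq yr; rewrite !in_itv/= => xq yr.
  exists q => //; exists r => //; exists n => //.
  have bx : ball (ratr q : R) h x by rewrite /ball/= ltr_norml; lra.
  have by_ : ball (ratr r : R) h y by rewrite /ball/= ltr_norml; lra.
  rewrite /B; case: asboolP => [_ //|]; case=> -[x' y'] [/= bx' by'].
  apply: eO; split => /=.
  - by apply: le_ball (ball_triangle (ball_sym bx) bx'); exact: ltW.
  - by apply: le_ball (ball_triangle (ball_sym by_) by'); exact: ltW.
apply: bigcupT_measurable_rat => q; apply: bigcupT_measurable_rat => r.
apply: bigcupT_measurable => n; rewrite /B; case: asboolP => // _.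
by apply: measurableX; apply: open_measurable; exact: ball_open.
Qed.

Lemma continuous_measurable_fun2 (R : realType) (F : R * R -> R) :
  continuous F -> measurable_fun setT F.
Proof.
move=> /continuousP cF; apply: (measurability _ (RGenOpens.measurableE R)).
move=> _ [_ [a [b ->] <-]]; rewrite setTI; apply: open_measurable2.
by apply: cF; exact: interval_open.
Qed.

Notation leb2 R := (@lebesgue_measure R \x @lebesgue_measure R)%E.

Definition rect (R : realType) (a b c d : R) : set (R * R) :=
  `[a, b]%classic `*` `[c, d]%classic.

Lemma measurable_rect (R : realType) (a b c d : R) : measurable (rect a b c d).
Proof. exact: measurableX. Qed.

Lemma leb2_rect (R : realType) (a b c d : R) : a <= b -> c <= d ->
  leb2 R (rect a b c d) = ((b - a) * (d - c))%:E.
Proof.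
move=> ab cd.
transitivity (@lebesgue_measure R `[a, b]%classic *
              @lebesgue_measure R `[c, d]%classic)%E.
  exact: product_measure1E.
rewrite !lebesgue_measure_itv/= !lte_fin.
by case: ltgtP ab cd => // ab _; case: ltgtP => // cd _;
  rewrite -?EFinB -?EFinM//= ?ab ?cd ?subrr ?mul0r ?mulr0 ?mul0e ?mule0.
Qed.

Lemma integrable_rect (R : realType) (a b c d : R) (F : R * R -> R) :
  a <= b -> c <= d -> continuous F ->
  (leb2 R).-integrable (rect a b c d) (EFin \o F).
Proof.
move=> ab cd cF.
have fin_rect : (leb2 R (rect a b c d) < +oo)%E by rewrite leb2_rect// ltry.
apply: measurable_bounded_integrable.
- exact: measurable_rect.
- exact: fin_rect.
- by apply: measurable_funS (continuous_measurable_fun2 cF).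
- have cpt : compact (rect a b c d) by apply: compact_setX; exact: segment_compact.
  have [] := compact_bounded (continuous_compact (continuous_subspaceT cF) cpt).
  move=> M [_ mrt]; exists M; split; rewrite ?num_real// => x Mx y Dy.
  by apply: mrt => //; exists y.
Qed.

Lemma continuous_pair1 (R : realType) (F : R * R -> R) (x : R) :
  continuous F -> continuous (fun y => F (x, y)).
Proof.
move=> cF y; apply: (@continuous_comp _ _ _ (fun y => (x, y)) F); last exact: cF.
by apply: (@cvg_pair _ _ _ (nbhs y) (nbhs x) (nbhs y));
  [exact: cvg_cst|exact: cvg_id].
Qed.

Lemma continuous_pair2 (R : realType) (F : R * R -> R) (y : R) :
  continuous F -> continuous (fun x => F (x, y)).
Proof.
move=> cF x; apply: (@continuous_comp _ _ _ (fun x => (x, y)) F); last exact: cF.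
by apply: (@cvg_pair _ _ _ (nbhs x) (nbhs x) (nbhs y));
  [exact: cvg_id|exact: cvg_cst].
Qed.

Lemma integrable_itv (R : realType) (a b : R) (f : R -> R) : continuous f ->
  (@lebesgue_measure R).-integrable `[a, b] (EFin \o f).
Proof.
move=> cf; apply: continuous_compact_integrable; first exact: segment_compact.
exact: continuous_subspaceT.
Qed.

Lemma Rintegral_eq0 (R : realType) (a b : R) (f : R -> R) :
  (forall x, f x = 0) -> \int[@lebesgue_measure R]_(x in `[a, b]) f x = 0.
Proof. by move=> f0; rewrite /Rintegral integral0_eq// => x _; rewrite f0. Qed.

Lemma Rintegral_rect (R : realType) (a b c d : R) (F : R * R -> R) :
  a <= b -> c <= d -> continuous F ->
  \int[leb2 R]_(z in rect a b c d) F z =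
  \int[@lebesgue_measure R]_(x in `[a, b])
     \int[@lebesgue_measure R]_(y in `[c, d]) F (x, y).
Proof.
move=> ab cd cF.
have iF := integrable_rect ab cd cF.
have iFr : (leb2 R).-integrable setT ((EFin \o F) \_ (rect a b c d)).
  by apply: (iffLR (integrable_mkcond _ _)); [exact: measurable_rect|exact: iF].
rewrite /Rintegral; congr fine.
rewrite integral_mkcond -integral12_prod_meas1//.
rewrite [RHS]integral_mkcond; apply: eq_integral => x _.
rewrite /fubini_F patchE; case: ifPn => xab; last first.
  rewrite integral0_eq// => y _; rewrite patchE ifF//.
  by apply/negbTE; apply: contra xab; rewrite !inE/= => -[].
rewrite fineK; last first.
  apply: integrable_fin_num => //.
  have h := @integrable_itv R c d _ (@continuous_pair1 R F x cF); exact h.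
rewrite [RHS]integral_mkcond; apply: eq_integral => y _.
rewrite !patchE; congr (if _ then _ else _).
by apply/idP/idP; rewrite !inE/=; [case|move=> ?; split=> //; rewrite inE in xab].
Qed.

Lemma Rintegral_rect_swap (R : realType) (a b c d : R) (F : R * R -> R) :
  a <= b -> c <= d -> continuous F ->
  \int[leb2 R]_(z in rect a b c d) F z =
  \int[@lebesgue_measure R]_(y in `[c, d])
     \int[@lebesgue_measure R]_(x in `[a, b]) F (x, y).
Proof.
move=> ab cd cF.
have iF := integrable_rect ab cd cF.
have iFr : (leb2 R).-integrable setT ((EFin \o F) \_ (rect a b c d)).
  by apply: (iffLR (integrable_mkcond _ _)); [exact: measurable_rect|exact: iF].
rewrite /Rintegral; congr fine.
rewrite integral_mkcond -integral21_prod_meas1//.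
rewrite [RHS]integral_mkcond; apply: eq_integral => y _.
rewrite /fubini_G patchE; case: ifPn => ycd; last first.
  rewrite integral0_eq// => x _; rewrite patchE ifF//.
  by apply/negbTE; apply: contra ycd; rewrite !inE/= => -[].
rewrite fineK; last first.
  apply: integrable_fin_num => //.
  have h := @integrable_itv R a b _ (@continuous_pair2 R F y cF); exact h.
rewrite [RHS]integral_mkcond; apply: eq_integral => x _.
rewrite !patchE; congr (if _ then _ else _).
by apply/idP/idP; rewrite !inE/=; [case|move=> ?; split=> //; rewrite inE in ycd].
Qed.

Lemma Rintegral_FTC2 (R : realType) (a b : R) (f F : R -> R) : a < b ->
  continuous f ->
  (forall x : R, a <= x <= b -> is_derive x (1 : R) F (f x)) ->
  \int[@lebesgue_measure R]_(x in `[a, b]) f x = F b - F a.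
Proof.
move=> ab cf dF.
have cF x : a <= x <= b -> {for x, continuous F}.
  move=> /dF dFx; apply: differentiable_continuous; exact/derivable1_diffP.
rewrite /Rintegral (@continuous_FTC2 _ f F)//.
- exact: continuous_subspaceT.
- split.
  + by move=> x /[!in_itv]/= /andP[ax xb]; have [] // := dF x; rewrite !ltW.
  + by apply: cvg_at_right_filter; apply: cF; rewrite lexx ltW.
  + by apply: cvg_at_left_filter; apply: cF; rewrite lexx ltW.
- move=> x /[!in_itv]/= /andP[ax xb].
  by have [|_ E] := dF x; [rewrite !ltW|rewrite derive1E E].
Qed.

Lemma exists_primitive (R : realType) (a : R) (f : R -> R) : continuous f ->
  exists F : R -> R, forall x : R, a < x -> is_derive x (1 : R) F (f x).
Proof.
move=> cf; exists (fun x => \int[@lebesgue_measure R]_(y in `[a, x]) f y).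
move=> x ax; have xx1 : x < x + 1 by rewrite ltrDl.
have [dF F'] := continuous_FTC1_closed xx1 (integrable_itv a (x + 1) cf) ax (cf x).
by split; [exact: dF|rewrite -derive1E F'].
Qed.

(** Reflections and translations of the variable are handled on a primitive: both
    sides are increments of the same function. *)
Lemma Rintegral_reflect (R : realType) (c : R) (f : R -> R) : 0 < c ->
  continuous f ->
  \int[@lebesgue_measure R]_(x in `[0, c]) f (c - x) =
  \int[@lebesgue_measure R]_(x in `[0, c]) f x.
Proof.
move=> c0 cf; have [F dF] := @exists_primitive R (-1) f cf.
have E1 : \int[@lebesgue_measure R]_(x in `[0, c]) f x = F c - F 0.
  by apply: Rintegral_FTC2 => // x /andP[x0 _]; apply: dF; lra.
have E2 : \int[@lebesgue_measure R]_(x in `[0, c]) f (c - x) =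
    - F (c - c) - - F (c - 0).
  apply: (@Rintegral_FTC2 R 0 c _ (fun x => - F (c - x))) => //.
  - move=> x; apply: (@continuous_comp _ _ _ (fun x => c - x) f); last exact: cf.
    by apply: cvgB; [exact: cvg_cst|exact: cvg_id].
  - move=> x /andP[_ xc].
    have dFc : is_derive (c - x) (1 : R) F (f (c - x)) by apply: dF; lra.
    have dc : is_derive x (1 : R) (fun x : R => c - x) (-1).
      by apply: is_derive_eq; rewrite add0r mul1r.
    have dN := is_deriveN (@is_derive1_comp R F (fun x => c - x) x _ _ dFc dc).
    by apply: (is_derive_eq dN); rewrite mulrN1 opprK.
by rewrite E1 E2 subrr subr0 opprK addrC.
Qed.

Lemma Rintegral_shift (R : realType) (b s : R) (f F : R -> R) : 0 < b -> 0 <= s ->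
  continuous f -> (forall x : R, -1 < x -> is_derive x (1 : R) F (f x)) ->
  \int[@lebesgue_measure R]_(x in `[0, b]) f (x + s) = F (b + s) - F s.
Proof.
move=> b0 s0 cf dF.
rewrite -[in F s](add0r s).
apply: (@Rintegral_FTC2 R 0 b _ (fun x => F (x + s))) => //.
+ move=> x; apply: (@continuous_comp _ _ _ (fun x => x + s) f); last exact: cf.
  by apply: cvgD; [exact: cvg_id|exact: cvg_cst].
+ move=> x /andP[x0 _].
  have dFc : is_derive (x + s) (1 : R) F (f (x + s)) by apply: dF; lra.
  have dc : is_derive x (1 : R) (fun x : R => x + s) 1.
    by apply: is_derive_eq; rewrite addr0.
  have dcomp := @is_derive1_comp R F (fun x => x + s) x _ _ dFc dc.
  by apply: (is_derive_eq dcomp); rewrite mulr1.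
Qed.

Lemma Rintegral_periodic (R : realType) (c : R) (f : R -> R) : 0 < c ->
  continuous f -> (forall x, f (x + (c + c)) = f x) ->
  \int[@lebesgue_measure R]_(x in `[0, c + c]) f (x + c) =
  \int[@lebesgue_measure R]_(x in `[0, c + c]) f x.
Proof.
move=> c0 cf per; have [F dF] := @exists_primitive R (-1) f cf.
have shift b s : 0 < b -> 0 <= s ->
    \int[@lebesgue_measure R]_(x in `[0, b]) f (x + s) = F (b + s) - F s.
  by move=> b0 s0; exact: Rintegral_shift.
have : \int[@lebesgue_measure R]_(x in `[0, c]) f (x + (c + c)) =
       \int[@lebesgue_measure R]_(x in `[0, c]) f (x + 0).
  by apply: eq_Rintegral => x _; rewrite per addr0.
have : \int[@lebesgue_measure R]_(x in `[0, c + c]) f x =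
       \int[@lebesgue_measure R]_(x in `[0, c + c]) f (x + 0).
  by apply: eq_Rintegral => x _; rewrite addr0.
rewrite !shift ?addr0 ?(addrA c c c); lra.
Qed.

(** * Estimates for the trigonometric functions *)

Lemma is_derive_ge0_le (R : realType) (f df : R -> R) (x : R) :
  (forall z : R, is_derive z (1 : R) f (df z)) ->
  (forall z, 0 <= z -> 0 <= df z) -> 0 <= x -> f 0 <= f x.
Proof.
move=> dfP df0 x0.
have cf : {within `[0, x], continuous f}.
  apply: continuous_subspaceT => z; apply: differentiable_continuous.
  by apply/derivable1_diffP.
have [c + E] := MVT_segment x0 (fun z _ => dfP z) cf.
rewrite in_itv/= => /andP[c0 _].
by rewrite -subr_ge0 E subr0 mulr_ge0// df0.
Qed.

Lemma sin_le_id (R : realType) (x : R) : 0 <= x -> sin x <= x.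
Proof.
move=> x0.
have D (z : R) : is_derive z (1 : R) (fun y => y - sin y) (1 - cos z).
  by apply: is_deriveB.
have := is_derive_ge0_le D _ x0; rewrite sin0 !subr0 subr_ge0; apply.
by move=> z _; rewrite subr_ge0 cos_le1.
Qed.

Lemma cos_ge_quadratic (R : realType) (x : R) : 0 <= x -> 1 - x ^+ 2 / 2 <= cos x.
Proof.
move=> x0.
have D (z : R) :
    is_derive z (1 : R) (fun y => cos y + y ^+ 2 / 2) (z - sin z).
  by apply: is_derive_eq; rewrite /GRing.scale/=; field.
have := is_derive_ge0_le D _ x0; rewrite cos0 => /(_ _)/wrap[].
  by move=> z z0; rewrite subr_ge0 sin_le_id.
by rewrite expr0n/= mul0r; lra.
Qed.

Lemma sin_ge_cubic (R : realType) (x : R) : 0 <= x -> x - x ^+ 3 / 6 <= sin x.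
Proof.
move=> x0.
have D (z : R) :
    is_derive z (1 : R) (fun y => sin y - (y - y ^+ 3 / 6))
      (cos z - (1 - z ^+ 2 / 2)).
  by apply: is_derive_eq; rewrite /GRing.scale/=; field.
have := is_derive_ge0_le D _ x0; rewrite sin0 => /(_ _)/wrap[].
  by move=> z z0; rewrite subr_ge0 cos_ge_quadratic.
by rewrite expr0n/= mul0r; lra.
Qed.

Lemma pi_lt4 (R : realType) : (pi : R) < 4.
Proof. by have := @pihalf_lt2 R; lra. Qed.

(** Injectivity of cos on [0, pi] in quantitative form; it makes arccos Hoelder
    continuous of exponent 1 / 2 up to the end points -1 and 1. *)
Lemma sub_cos_ge (R : realType) (a b : R) : 0 <= a <= pi -> 0 <= b <= pi ->
  (a - b) ^+ 2 / 18 <= `|cos a - cos b|.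
Proof.
wlog ab : a b / a <= b.
  move=> H ha hb; have [/H|/ltW /H] := leP a b; first exact.
  by rewrite distrC -sqrrN opprB; exact.
move=> /andP[a0 api] /andP[b0 bpi].
pose h := (b - a) / 2; pose m := (a + b) / 2.
(* The half difference h is at most 2, where the cubic bound gives h / 3. *)
have sinh_ge : h / 3 <= sin h.
  have h0 : 0 <= h by rewrite /h; lra.
  have h2 : h <= 2 by have := @pi_lt4 R; rewrite /h; lra.
  by apply: le_trans (sin_ge_cubic h0); nra.
have sinm_ge : sin h <= sin m.
  have -> : h = b / 2 - a / 2 by rewrite /h; field.
  have -> : m = b / 2 + a / 2 by rewrite /m; field.
  rewrite sinB sinD -subr_ge0.
  have ca : 0 <= cos (b / 2) by apply: cos_ge0_pihalf; have := @pi_ge0 R; lra.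
  have sa : 0 <= sin (a / 2) by apply: sin_ge0_pi; have := @pi_ge0 R; lra.
  by have := mulr_ge0 ca sa; lra.
have -> : cos a - cos b = 2 * (sin m * sin h).
  have -> : a = m - h by rewrite /m /h; field.
  have -> : b = m + h by rewrite /m /h; field.
  by rewrite cosB cosD; ring.
have h0 : 0 <= h by rewrite /h; lra.
apply: le_trans (ler_norm _).
have -> : (a - b) ^+ 2 = 4 * h ^+ 2 by rewrite /h; field.
by nra.
Qed.

Lemma acos_itv (R : realType) (u : R) : `|u| <= 1 -> 0 <= acos u <= pi.
Proof. by rewrite ler_norml => u1; rewrite acos_ge0// acos_lepi. Qed.

Lemma norm_acosK (R : realType) (u : R) : `|u| <= 1 -> cos (acos u) = u.
Proof. by rewrite ler_norml => u1; rewrite acosK// in_itv. Qed.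

Lemma acos_dist (R : realType) (u v : R) : `|u| <= 1 -> `|v| <= 1 ->
  `|acos u - acos v| <= Num.sqrt (18 * `|u - v|).
Proof.
move=> u1 v1.
rewrite -sqrtr_sqr; apply: ler_wsqrtr.
have := sub_cos_ge (acos_itv u1) (acos_itv v1).
by rewrite !norm_acosK//; lra.
Qed.

Lemma acos_lt_acos (R : realType) (u v : R) : `|u| <= 1 -> `|v| <= 1 ->
  (acos u < acos v) = (v < u).
Proof.
move=> u1 v1; rewrite -[in RHS](norm_acosK u1) -[in RHS](norm_acosK v1).
by rewrite ltr_cos// in_itv/= acos_itv.
Qed.

Lemma exists_angle (R : realType) (a b : R) : a ^+ 2 + b ^+ 2 = 1 ->
  exists t, [/\ 0 <= t <= 2 * pi, a = cos t & b = sin t].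
Proof.
move=> ab1.
have a1 : `|a| <= 1 by rewrite ler_norml; nra.
have sE : sin (acos a) = `|b|.
  rewrite sin_acos -?ler_norml// -sqrtr_sqr; congr Num.sqrt; lra.
have /andP[t0 tpi] := acos_itv a1.
have [b0|b0] := leP 0 b.
  exists (acos a); rewrite norm_acosK// sE ger0_norm//; split=> //.
  by have := @pi_ge0 R; lra.
exists (2 * pi - acos a); split.
- by have := @pi_ge0 R; lra.
- have -> : 2 * pi - acos a = - acos a + pi *+ 2 by ring.
  by rewrite cosD2pi cosN norm_acosK.
- have -> : 2 * pi - acos a = - acos a + pi *+ 2 by ring.
  by rewrite sinD2pi sinN sE ltr0_norm// opprK.
Qed.

(** * Euclidean geometry of the unit sphere *)

(** Written with the entries of [spherical], which is convertible to a [vec3]. *)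
Definition vec3 (R : realType) (a b c : R) : 'rV[R]_3 :=
  \row_(i < 3) [:: a; b; c]`_i.

Notation x0_ x := (x ord0 ord0).
Notation x1_ x := (x ord0 (lift ord0 ord0)).
Notation x2_ x := (x ord0 (lift ord0 (lift ord0 ord0))).

Lemma vec3_ext (R : realType) (x y : 'rV[R]_3) :
  x0_ x = x0_ y -> x1_ x = x1_ y -> x2_ x = x2_ y -> x = y.
Proof.
move=> h0 h1 h2; apply/rowP => i.
case: (unliftP ord0 i) => [j ->|-> //]; case: (unliftP ord0 j) => [k ->|-> //].
by rewrite ord1.
Qed.

Lemma vec3E (R : realType) (a b c : R) :
  (x0_ (vec3 a b c) = a) * (x1_ (vec3 a b c) = b) * (x2_ (vec3 a b c) = c).
Proof. by rewrite !mxE. Qed.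

Lemma vec3_eta (R : realType) (x : 'rV[R]_3) : x = vec3 (x0_ x) (x1_ x) (x2_ x).
Proof. by apply: vec3_ext; rewrite vec3E. Qed.

Lemma dotE (R : realType) (x y : 'rV[R]_3) :
  dot x y = x0_ x * x0_ y + x1_ x * x1_ y + x2_ x * x2_ y.
Proof. by rewrite /dot !big_ord_recl big_ord0 addr0 addrA. Qed.

Lemma dotC (R : realType) (x y : 'rV[R]_3) : dot x y = dot y x.
Proof. by rewrite !dotE; ring. Qed.

Lemma dotDl (R : realType) (x y z : 'rV[R]_3) : dot (x + y) z = dot x z + dot y z.
Proof. by rewrite !dotE !mxE; ring. Qed.

Lemma dotDr (R : realType) (x y z : 'rV[R]_3) : dot z (x + y) = dot z x + dot z y.
Proof. by rewrite !dotE !mxE; ring. Qed.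

Lemma dotZl (R : realType) k (x z : 'rV[R]_3) : dot (k *: x) z = k * dot x z.
Proof. by rewrite !dotE !mxE; ring. Qed.

Lemma dotZr (R : realType) k (x z : 'rV[R]_3) : dot z (k *: x) = k * dot z x.
Proof. by rewrite !dotE !mxE; ring. Qed.

Lemma dotNl (R : realType) (x z : 'rV[R]_3) : dot (- x) z = - dot x z.
Proof. by rewrite !dotE !mxE; ring. Qed.

Lemma dotNr (R : realType) (x z : 'rV[R]_3) : dot z (- x) = - dot z x.
Proof. by rewrite !dotE !mxE; ring. Qed.

Lemma dot0r (R : realType) (z : 'rV[R]_3) : dot z 0 = 0.
Proof. by rewrite !dotE !mxE; ring. Qed.

Definition dot_lin := (dotDl, dotDr, dotNl, dotNr, dotZl, dotZr).

Lemma dot_ge0 (R : realType) (x : 'rV[R]_3) : 0 <= dot x x.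
Proof. by rewrite dotE; nra. Qed.

Lemma dot_eq0 (R : realType) (x : 'rV[R]_3) : dot x x = 0 -> x = 0.
Proof.
rewrite dotE => h.
by apply: vec3_ext; rewrite !mxE; apply/eqP; rewrite -sqrf_eq0; apply/eqP; nra.
Qed.

Lemma dot_gt0 (R : realType) (x : 'rV[R]_3) : x != 0 -> 0 < dot x x.
Proof.
move=> x0; rewrite lt0r dot_ge0 andbT; apply: contra x0 => /eqP /dot_eq0 ->.
exact: eqxx.
Qed.

Definition cross (R : realType) (x y : 'rV[R]_3) : 'rV[R]_3 :=
  vec3 (x1_ x * x2_ y - x2_ x * x1_ y) (x2_ x * x0_ y - x0_ x * x2_ y)
       (x0_ x * x1_ y - x1_ x * x0_ y).

Lemma dot_cross (R : realType) (x y : 'rV[R]_3) :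
  dot (cross x y) (cross x y) = dot x x * dot y y - dot x y ^+ 2.
Proof. by rewrite !dotE !vec3E; ring. Qed.

Lemma dot_crossl (R : realType) (x y : 'rV[R]_3) : dot x (cross x y) = 0.
Proof. by rewrite !dotE !vec3E; ring. Qed.

Lemma dot_crossr (R : realType) (x y : 'rV[R]_3) : dot y (cross x y) = 0.
Proof. by rewrite !dotE !vec3E; ring. Qed.

Lemma cross_cross (R : realType) (x y z : 'rV[R]_3) :
  cross x (cross y z) = dot x z *: y - dot x y *: z.
Proof.
by apply: vec3_ext; rewrite /cross ?vec3E ![in RHS]mxE !dotE ?vec3E; ring.
Qed.

Lemma sphereE (R : realType) (x : 'rV[R]_3) : sphere x <-> dot x x = 1.
Proof.
rewrite /sphere/= /enorm; split=> [h|->]; last by rewrite sqrtr1.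
by rewrite -(sqr_sqrtr (dot_ge0 x)) h expr1n.
Qed.

Lemma norm_dot_le1 (R : realType) (x y : 'rV[R]_3) :
  sphere x -> sphere y -> `|dot x y| <= 1.
Proof.
move=> /sphereE hx /sphereE hy.
have := dot_ge0 (cross x y); rewrite dot_cross hx hy mul1r => h.
by rewrite ler_norml; nra.
Qed.

Lemma sphere_normalize (R : realType) (x : 'rV[R]_3) :
  x != 0 -> sphere ((enorm x)^-1 *: x).
Proof.
move=> /dot_gt0 h; apply/sphereE; rewrite !dot_lin.
have e0 : 0 < enorm x by rewrite sqrtr_gt0.
have -> : dot x x = enorm x ^+ 2 by rewrite sqr_sqrtr// ltW.
by field; rewrite gt_eqF.
Qed.

Lemma enorm_gt0 (R : realType) (x : 'rV[R]_3) : x != 0 -> 0 < enorm x.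
Proof. by move=> /dot_gt0 h; rewrite sqrtr_gt0. Qed.

Lemma enorm_ge0 (R : realType) (x : 'rV[R]_3) : 0 <= enorm x.
Proof. exact: sqrtr_ge0. Qed.

Lemma exists_orthogonal (R : realType) (c : 'rV[R]_3) :
  exists e, sphere e /\ dot c e = 0.
Proof.
suff [e e0 ce] : exists2 e, e != 0 & dot c e = 0.
  exists ((enorm e)^-1 *: e); split; first exact: sphere_normalize.
  by rewrite dotZr ce mulr0.
have [h|h] := eqVneq (x0_ c) 0.
- exists (vec3 1 0 0); last by rewrite dotE !vec3E h; ring.
  apply/eqP => /(congr1 (fun v : 'rV[R]_3 => x0_ v)); rewrite vec3E mxE.
  by apply/eqP; rewrite oner_eq0.
- exists (vec3 (- x1_ c) (x0_ c) 0); last by rewrite dotE !vec3E; ring.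
  by apply: contra h => /eqP /(congr1 (fun v : 'rV[R]_3 => x1_ v));
    rewrite vec3E mxE => ->.
Qed.

(** Polar coordinates around an arbitrary centre: e is the direction in which
    the geodesic from c to x leaves c. *)
Lemma polar_form (R : realType) (c x : 'rV[R]_3) : sphere c -> sphere x ->
  exists e, [/\ sphere e, dot c e = 0 &
    x = cos (acos (dot c x)) *: c + sin (acos (dot c x)) *: e].
Proof.
move=> Sc Sx; have k1 := norm_dot_le1 Sc Sx.
set a := acos _; have ca : cos a = dot c x by rewrite norm_acosK.
have sca := cos2Dsin2 a.
pose v := x - cos a *: c.
have vv : dot v v = sin a ^+ 2.
  rewrite /v !dot_lin (dotC x c) -ca.
  by move/sphereE: Sc => ->; move/sphereE: Sx => ->; nra.
have cv : dot c v = 0.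
  by rewrite /v !dot_lin; move/sphereE: Sc => ->; rewrite ca; ring.
have xE : x = cos a *: c + v by rewrite /v addrC subrK.
have [s0|s0] := eqVneq (sin a) 0.
  have [e [Se ce]] := exists_orthogonal c.
  have v0 : v = 0 by apply: dot_eq0; rewrite vv s0 expr0n.
  by exists e; split=> //; rewrite s0 scale0r [LHS]xE v0.
exists ((sin a)^-1 *: v); split.
- by apply/sphereE; rewrite dotZl dotZr vv; field.
- by rewrite dotZr cv mulr0.
- by rewrite scalerA divff// scale1r.
Qed.

Lemma dot_polar (R : realType) (c e f : 'rV[R]_3) (a b : R) :
  sphere c -> dot c e = 0 -> dot c f = 0 ->
  dot (cos a *: c + sin a *: e) (cos b *: c + sin b *: f) =
  cos a * cos b + sin a * sin b * dot e f.
Proof.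
move=> /sphereE cc ce cf; rewrite !dot_lin (dotC e c) cc ce cf; ring.
Qed.

Lemma acos_dot_itv (R : realType) (x y : 'rV[R]_3) : sphere x -> sphere y ->
  0 <= acos (dot x y) <= pi.
Proof. by move=> Sx Sy; apply: acos_itv; exact: norm_dot_le1. Qed.

(** In polar form around x, with angles a and b, the inner product <y, z> is
    cos a cos b + sin a sin b <e, f>, which is at most cos (a - b). *)
Lemma geodesic_triangle (R : realType) (x y z : 'rV[R]_3) :
  sphere x -> sphere y -> sphere z ->
  `|acos (dot x y) - acos (dot x z)| <= acos (dot y z).
Proof.
move=> Sx Sy Sz.
have [e [Se xe yE]] := polar_form Sx Sy; have [f [Sf xf zE]] := polar_form Sx Sz.
have a_itv := acos_dot_itv Sx Sy; have b_itv := acos_dot_itv Sx Sz.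
move: yE zE a_itv b_itv; set a := acos (dot x y); set b := acos (dot x z).
move=> yE zE /andP[a0 api] /andP[b0 bpi].
have yz1 := norm_dot_le1 Sy Sz.
have sa : 0 <= sin a by apply: sin_ge0_pi; rewrite a0.
have sb : 0 <= sin b by apply: sin_ge0_pi; rewrite b0.
have yz : dot y z <= cos `|a - b|.
  rewrite cos_norm cosB yE zE dot_polar// lerD2l.
  have := norm_dot_le1 Se Sf; rewrite ler_norml => /andP[_ ef].
  by rewrite -[leRHS]mulr1 ler_wpM2l// mulr_ge0.
have ab_itv : 0 <= `|a - b| <= pi by rewrite normr_ge0 ler_norml; lra.
rewrite leNgt; apply/negP; rewrite -ltr_cos ?in_itv ?ab_itv ?acos_itv//.
by rewrite norm_acosK// ltNge yz.
Qed.

Lemma acos_dotN (R : realType) (x y : 'rV[R]_3) : sphere x -> sphere y ->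
  acos (dot (- x) y) = pi - acos (dot x y).
Proof.
by move=> Sx Sy; rewrite dotNl acosN// -ler_norml; exact: norm_dot_le1.
Qed.

Lemma enorm_sub (R : realType) (y z : 'rV[R]_3) : sphere y -> sphere z ->
  enorm (y - z) = 2 * sin (acos (dot y z) / 2).
Proof.
move=> Sy Sz; have /andP[d0 dpi] := acos_dot_itv Sy Sz; set d := acos _ in d0 dpi *.
have s0 : 0 <= sin (d / 2) by apply: sin_ge0_pi; lra.
rewrite /enorm; have -> : dot (y - z) (y - z) = (2 * sin (d / 2)) ^+ 2.
  rewrite !dot_lin (dotC z y); move/sphereE: (Sy) => ->; move/sphereE: (Sz) => ->.
  have -> : dot y z = cos (d / 2 + d / 2).
    by rewrite -(norm_acosK (norm_dot_le1 Sy Sz)) -/d; congr cos; field.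
  by rewrite cosD; have := cos2Dsin2 (d / 2); nra.
by rewrite sqrtr_sqr ger0_norm// mulr_ge0.
Qed.

Lemma acos_sub_cubic_le (R : realType) (y z : 'rV[R]_3) : sphere y -> sphere z ->
  acos (dot y z) - acos (dot y z) ^+ 3 / 24 <= enorm (y - z).
Proof.
move=> Sy Sz; rewrite enorm_sub//; have /andP[d0 _] := acos_dot_itv Sy Sz.
by have := @sin_ge_cubic R (acos (dot y z) / 2); lra.
Qed.

Lemma sphericalE (R : realType) (t p : R) :
  spherical t p = vec3 (sin p * cos t) (sin p * sin t) (cos p).
Proof. by []. Qed.

Lemma sphere_spherical (R : realType) (t p : R) : sphere (spherical t p).
Proof.
apply/sphereE; rewrite sphericalE dotE !vec3E.
have -> : sin p * cos t * (sin p * cos t) + sin p * sin t * (sin p * sin t)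
   + cos p * cos p = sin p ^+ 2 * (cos t ^+ 2 + sin t ^+ 2) + cos p ^+ 2 by ring.
by rewrite cos2Dsin2 mulr1 addrC cos2Dsin2.
Qed.

Lemma spherical_surj (R : realType) (x : 'rV[R]_3) : sphere x ->
  exists t p, [/\ 0 <= t <= 2 * pi, 0 <= p <= pi & x = spherical t p].
Proof.
move=> /sphereE; rewrite dotE => h.
have x21 : `|x2_ x| <= 1 by rewrite ler_norml; nra.
have p_itv := acos_itv x21; set p := acos _ in p_itv.
have cp : cos p = x2_ x by rewrite norm_acosK.
have sp := cos2Dsin2 p; have [s0|s0] := eqVneq (sin p) 0.
  exists 0, p; split=> //; first by have := @pi_ge0 R; lra.
  rewrite sphericalE s0 !mul0r cp [LHS]vec3_eta; congr vec3; nra.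
have [t [t_itv ct st]] : exists t, [/\ 0 <= t <= 2 * pi,
    x0_ x / sin p = cos t & x1_ x / sin p = sin t].
  apply: exists_angle; rewrite !expr_div_n -mulrDl.
  have -> : x0_ x ^+ 2 + x1_ x ^+ 2 = sin p ^+ 2 by rewrite -cp in h; nra.
  by rewrite divff// expf_neq0.
exists t, p; split=> //; rewrite sphericalE -ct -st cp [LHS]vec3_eta.
by congr vec3; field.
Qed.

(** * The surface integral on continuous functions *)

(** Continuity of f on the sphere, read in longitude and colatitude; this is
    the form in which the surface integral uses it. *)
Definition scont (R : realType) (f : 'rV[R]_3 -> R) : Prop :=
  continuous (fun z : R * R => f (spherical z.1 z.2)).

Lemma continuous_cos1 (R : realType) : continuous (fun z : R * R => cos z.1).
Proof.
move=> z; apply: (@continuous_comp _ _ _ fst (@cos R)); first exact: cvg_fst.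
exact: continuous_cos.
Qed.

Lemma continuous_sin1 (R : realType) : continuous (fun z : R * R => sin z.1).
Proof.
move=> z; apply: (@continuous_comp _ _ _ fst (@sin R)); first exact: cvg_fst.
exact: continuous_sin.
Qed.

Lemma continuous_cos2 (R : realType) : continuous (fun z : R * R => cos z.2).
Proof.
move=> z; apply: (@continuous_comp _ _ _ snd (@cos R)); first exact: cvg_snd.
exact: continuous_cos.
Qed.

Lemma continuous_sin2 (R : realType) : continuous (fun z : R * R => sin z.2).
Proof.
move=> z; apply: (@continuous_comp _ _ _ snd (@sin R)); first exact: cvg_snd.
exact: continuous_sin.
Qed.

Lemma scont_dot (R : realType) (y : 'rV[R]_3) : scont (fun x => dot x y).
Proof.
rewrite /scont; under eq_fun do rewrite sphericalE dotE !vec3E.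
move=> z; have [c1 s1] := (@continuous_cos1 R z, @continuous_sin1 R z).
have [c2 s2] := (@continuous_cos2 R z, @continuous_sin2 R z).
apply: cvgD; first apply: cvgD; apply: cvgM; try exact: cvg_cst.
- by apply: cvgM; [exact: s2|exact: c1].
- by apply: cvgM; [exact: s2|exact: s1].
- exact: c2.
Qed.

(** Lipschitz functions for the geodesic distance are continuous: the distance
    to a fixed point is the Hoelder image of a linear function. *)
Lemma scont_lipschitz (R : realType) (f : 'rV[R]_3 -> R) :
  (forall x y, sphere x -> sphere y -> `|f x - f y| <= acos (dot x y)) ->
  scont f.
Proof.
move=> lip [t0 p0]; set y := spherical t0 p0.
have Sy : sphere y by exact: sphere_spherical.
pose h (z : R * R) := Num.sqrt (18 * `|dot (spherical z.1 z.2) y - 1|).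
have fh z : `|f y - f (spherical z.1 z.2)| <= h z.
  have Sz := sphere_spherical z.1 z.2.
  rewrite distrC; apply: le_trans (lip _ _ Sz Sy) _.
  have := acos_dist (norm_dot_le1 Sz Sy) (ltac:(rewrite normr1//) : `|1 : R| <= 1).
  by rewrite acos1 subr0; apply: le_trans; exact: ler_norm.
have h0 : h z @[z --> (t0, p0)] --> (0 : R).
  have -> : 0 = h (t0, p0) :> R.
    rewrite /h/= -/y; move/sphereE : Sy => ->.
    by rewrite subrr normr0 mulr0 sqrtr0.
  apply: (@continuous_comp _ _ _
    (fun z : R * R => 18 * `|dot (spherical z.1 z.2) y - 1|) (@Num.sqrt R));
    last exact: sqrt_continuous.
  apply: cvgM; first exact: cvg_cst.
  apply: (@cvg_norm _ R); apply: cvgB; last exact: cvg_cst.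
  exact: scont_dot.
apply/(@cvgrPdist_lt _ R^o) => e e0.
have /(@cvgrPdist_lt _ R^o)/(_ e e0) := h0; apply: filterS => z.
rewrite sub0r normrN ger0_norm ?sqrtr_ge0//.
exact: le_lt_trans.
Qed.

Lemma scont_cst (R : realType) (c : R) : scont (fun=> c).
Proof. by move=> z; exact: cvg_cst. Qed.

Lemma scontD (R : realType) (f g : 'rV[R]_3 -> R) :
  scont f -> scont g -> scont (fun x => f x + g x).
Proof. by move=> cf cg z; apply: cvgD; [exact: cf|exact: cg]. Qed.

Lemma scontB (R : realType) (f g : 'rV[R]_3 -> R) :
  scont f -> scont g -> scont (fun x => f x - g x).
Proof. by move=> cf cg z; apply: cvgB; [exact: cf|exact: cg]. Qed.

Lemma scontZ (R : realType) (k : R) (f : 'rV[R]_3 -> R) :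
  scont f -> scont (fun x => k * f x).
Proof. by move=> cf z; apply: cvgM; [exact: cvg_cst|exact: cf]. Qed.

Lemma scont_norm (R : realType) (f : 'rV[R]_3 -> R) :
  scont f -> scont (fun x => `|f x|).
Proof. by move=> cf z; apply: (@cvg_norm _ R); exact: cf. Qed.

Lemma scont_max (R : realType) (f g : 'rV[R]_3 -> R) :
  scont f -> scont g -> scont (fun x => Num.max (f x) (g x)).
Proof. by move=> cf cg z; apply: continuous_max; [exact: cf|exact: cg]. Qed.

Lemma scont_min (R : realType) (f g : 'rV[R]_3 -> R) :
  scont f -> scont g -> scont (fun x => Num.min (f x) (g x)).
Proof. by move=> cf cg z; apply: continuous_min; [exact: cf|exact: cg]. Qed.

Lemma scont_sum (R : realType) (n : nat) (F : nat -> 'rV[R]_3 -> R) :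
  (forall i, scont (F i)) -> scont (fun x => \sum_(0 <= i < n) F i x).
Proof.
move=> cF; elim: n => [|n IHn] z.
  by under eq_fun do rewrite big_nil; exact: cvg_cst.
under eq_fun do rewrite big_nat_recr//=.
by apply: cvgD; [exact: IHn|exact: cF].
Qed.

Lemma antipode_spherical (R : realType) (t p : R) :
  - spherical t p = spherical (t + pi) (pi - p).
Proof.
rewrite !sphericalE; apply: vec3_ext; rewrite mxE !vec3E.
- by rewrite cosDpi sinB sinpi cospi; ring.
- by rewrite sinDpi sinB sinpi cospi; ring.
- by rewrite cosB sinpi cospi; ring.
Qed.

Lemma scontN (R : realType) (f : 'rV[R]_3 -> R) :
  scont f -> scont (fun x => f (- x)).
Proof.
move=> cf; rewrite /scont; under eq_fun do rewrite antipode_spherical.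
move=> z; apply: (@continuous_comp _ _ _
  (fun z : R * R => (z.1 + pi, pi - z.2)) (fun z => f (spherical z.1 z.2)));
  last exact: cf.
apply: (@cvg_pair _ _ _ (nbhs z) (nbhs (z.1 + pi)) (nbhs (pi - z.2))).
- by apply: cvgD; [exact: cvg_fst|exact: cvg_cst].
- by apply: cvgB; [exact: cvg_cst|exact: cvg_snd].
Qed.

Notation srect R := (rect 0 (2 * pi) 0 (pi : R)).

Lemma sphere_integralE (R : realType) (f : 'rV[R]_3 -> R) :
  sphere_integral f =
  \int[leb2 R]_(z in srect R) (f (spherical z.1 z.2) * sin z.2).
Proof. by []. Qed.

Lemma twopi_ge0 (R : realType) : 0 <= 2 * pi :> R.
Proof. by have := @pi_ge0 R; lra. Qed.

Lemma scont_integrand (R : realType) (f : 'rV[R]_3 -> R) : scont f ->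
  continuous (fun z : R * R => f (spherical z.1 z.2) * sin z.2).
Proof. by move=> cf z; apply: cvgM; [exact: cf|exact: continuous_sin2]. Qed.

Lemma scont_integrable (R : realType) (f : 'rV[R]_3 -> R) : scont f ->
  (leb2 R).-integrable (srect R)
    (EFin \o (fun z : R * R => f (spherical z.1 z.2) * sin z.2)).
Proof.
move=> cf; apply: integrable_rect; [exact: twopi_ge0|exact: pi_ge0|].
exact: scont_integrand.
Qed.

Lemma eq_sphere_integral (R : realType) (f g : 'rV[R]_3 -> R) :
  (forall x, sphere x -> f x = g x) -> sphere_integral f = sphere_integral g.
Proof.
by move=> fg; apply: eq_Rintegral => z _; rewrite fg//; exact: sphere_spherical.
Qed.

Lemma le_sphere_integral (R : realType) (f g : 'rV[R]_3 -> R) :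
  scont f -> scont g -> (forall x, sphere x -> f x <= g x) ->
  sphere_integral f <= sphere_integral g.
Proof.
move=> cf cg fg; rewrite !sphere_integralE; apply: le_Rintegral.
- exact: measurable_rect.
- exact: scont_integrable.
- exact: scont_integrable.
- move=> z [_ /=]; rewrite in_itv/= => z_itv.
  by rewrite ler_wpM2r ?sin_ge0_pi// fg//; exact: sphere_spherical.
Qed.

Lemma sphere_integral_ge0 (R : realType) (f : 'rV[R]_3 -> R) :
  (forall x, sphere x -> 0 <= f x) -> 0 <= sphere_integral f.
Proof.
move=> f0; apply: Rintegral_ge0 => z [_ /=]; rewrite in_itv/= => z_itv.
by rewrite mulr_ge0 ?sin_ge0_pi// f0//; exact: sphere_spherical.
Qed.

Lemma sphere_integralD (R : realType) (f g : 'rV[R]_3 -> R) :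
  scont f -> scont g ->
  sphere_integral (fun x => f x + g x) = sphere_integral f + sphere_integral g.
Proof.
move=> cf cg; rewrite !sphere_integralE -RintegralD.
- by apply: eq_Rintegral => z _; rewrite mulrDl.
- exact: measurable_rect.
- exact: scont_integrable.
- exact: scont_integrable.
Qed.

Lemma sphere_integralZ (R : realType) (k : R) (f : 'rV[R]_3 -> R) :
  scont f -> sphere_integral (fun x => k * f x) = k * sphere_integral f.
Proof.
move=> cf; rewrite !sphere_integralE -RintegralZl.
- by apply: eq_Rintegral => z _; rewrite mulrA.
- exact: measurable_rect.
- exact: scont_integrable.
Qed.

Lemma sphere_integralB (R : realType) (f g : 'rV[R]_3 -> R) :
  scont f -> scont g ->
  sphere_integral (fun x => f x - g x) = sphere_integral f - sphere_integral g.
Proof.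
move=> cf cg; rewrite -(mulN1r (sphere_integral g)) -sphere_integralZ//.
rewrite -sphere_integralD//; last exact: scontZ.
by apply: eq_sphere_integral => x _; rewrite mulN1r.
Qed.

Lemma sphere_integral_colatitude (R : realType) (f : 'rV[R]_3 -> R) (h : R -> R) :
  continuous h -> (forall t p, f (spherical t p) * sin p = h p) -> scont f ->
  sphere_integral f = 2 * pi * \int[@lebesgue_measure R]_(p in `[0, pi]) h p.
Proof.
move=> ch fh cf; rewrite sphere_integralE.
rewrite Rintegral_rect ?twopi_ge0 ?pi_ge0//; last exact: scont_integrand.
pose I := \int[@lebesgue_measure R]_(p in `[0, pi]) h p.
transitivity (\int[@lebesgue_measure R]_(t in `[0, 2 * pi]) I).
  by apply: eq_Rintegral => t _; apply: eq_Rintegral => p _; rewrite fh.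
rewrite (@Rintegral_cst _ _ _ (@lebesgue_measure R))// mulrC; congr (_ * I).
transitivity (fine (@lebesgue_measure R `[0, 2 * pi]%classic)); first by [].
rewrite lebesgue_measure_itv/= lte_fin ifT -?EFinB/= ?subr0//.
by have := @pi_gt0 R; lra.
Qed.

Lemma sphere_integral_cst (R : realType) (c : R) :
  sphere_integral (fun=> c) = 4 * pi * c.
Proof.
have cs : continuous (fun p : R => c * sin p).
  by move=> p; apply: cvgM; [exact: cvg_cst|exact: continuous_sin].
rewrite (sphere_integral_colatitude cs)//; last exact: scont_cst.
have -> : \int[@lebesgue_measure R]_(p in `[0, pi]) (c * sin p) =
    - c * cos pi - - c * cos 0.
  apply: (@Rintegral_FTC2 R 0 pi _ (fun p => - c * cos p)) => //.
    exact: pi_gt0.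
  by move=> p _; apply: is_derive_eq; rewrite /GRing.scale/= mulrNN.
by rewrite cospi cos0; ring.
Qed.

Lemma sphere_integral_sum (R : realType) (n : nat) (F : nat -> 'rV[R]_3 -> R) :
  (forall i, scont (F i)) ->
  sphere_integral (fun x => \sum_(0 <= i < n) F i x) =
  \sum_(0 <= i < n) sphere_integral (F i).
Proof.
move=> cF; elim: n => [|n IHn].
  transitivity (@sphere_integral R (fun=> 0)).
    by apply: eq_sphere_integral => x _; rewrite big_nil.
  by rewrite big_nil sphere_integral_cst mulr0.
rewrite big_nat_recr//= -IHn -sphere_integralD//; last exact: scont_sum.
by apply: eq_sphere_integral => x _; rewrite big_nat_recr.
Qed.

(** In coordinates the antipodal map is a reflection in colatitude combined
    with a half turn in longitude, and the integrand is periodic in longitude. *)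
Lemma sphere_integral_antipode (R : realType) (f : 'rV[R]_3 -> R) : scont f ->
  sphere_integral (fun x => f (- x)) = sphere_integral f.
Proof.
move=> cf; have cfN := scontN cf.
have p0 := @pi_gt0 R; have pp0 : 0 <= pi + pi :> R by lra.
pose F (z : R * R) := f (spherical z.1 z.2) * sin z.2.
have cF : continuous F by exact: scont_integrand.
pose G (z : R * R) := F (z.1, pi - z.2).
have cG : continuous G.
  move=> z; apply: (@continuous_comp _ _ _ (fun z : R * R => (z.1, pi - z.2)) F);
    last exact: cF.
  apply: (@cvg_pair _ _ _ (nbhs z) (nbhs z.1) (nbhs (pi - z.2))).
  - exact: cvg_fst.
  - by apply: cvgB; [exact: cvg_cst|exact: cvg_snd].
have E2 : 2 * pi = pi + pi :> R by ring.
rewrite !sphere_integralE E2.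
transitivity (\int[leb2 R]_(z in rect 0 (pi + pi) 0 pi) G z).
  rewrite (Rintegral_rect_swap pp0 (ltW p0) (scont_integrand cfN)).
  rewrite (Rintegral_rect_swap pp0 (ltW p0) cG).
  apply: eq_Rintegral => p _.
  rewrite -[RHS](@Rintegral_periodic R pi (fun t => G (t, p)))//.
  - apply: eq_Rintegral => t _; rewrite /G /F/= antipode_spherical.
    by rewrite sinB sinpi cospi; congr (_ * _); ring.
  - exact: continuous_pair2.
  - move=> t; rewrite /G /F/=; congr (f _ * _); rewrite !sphericalE.
    have -> : t + (pi + pi) = t + pi *+ 2 by ring.
    by rewrite cosD2pi sinD2pi.
rewrite (Rintegral_rect pp0 (ltW p0) cG).
rewrite (Rintegral_rect pp0 (ltW p0) cF).
apply: eq_Rintegral => t _.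
rewrite -[RHS](@Rintegral_reflect R pi (fun p => F (t, p)))//.
exact: continuous_pair1.
Qed.

(** * Rotation invariance of the surface integral *)

(** Continuously differentiable functions of two inner products, given by a
    chain rule along curves in the square [-1, 1]^2. *)
Definition C1_square (R : realType) (H Hu Hv : R -> R -> R) (M : R) : Prop :=
  [/\ forall (u v : R -> R) (s u' v' : R),
        is_derive s (1 : R) u u' -> is_derive s (1 : R) v v' ->
        `|u s| <= 1 -> `|v s| <= 1 ->
        is_derive s (1 : R) (fun r => H (u r) (v r))
          (Hu (u s) (v s) * u' + Hv (u s) (v s) * v'),
      forall u v : R * R -> R, continuous u -> continuous v ->
        (forall z, `|u z| <= 1) -> (forall z, `|v z| <= 1) ->
        [/\ continuous (fun z => H (u z) (v z)),
            continuous (fun z => Hu (u z) (v z)) &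
            continuous (fun z => Hv (u z) (v z))] &
      forall u v, `|u| <= 1 -> `|v| <= 1 -> `|Hu u v| <= M /\ `|Hv u v| <= M].

Definition is_derive3 (R : realType) (s : R) (y : R -> 'rV[R]_3)
    (y' : 'rV[R]_3) : Prop :=
  [/\ is_derive s (1 : R) (fun r => x0_ (y r)) (x0_ y'),
      is_derive s (1 : R) (fun r => x1_ (y r)) (x1_ y') &
      is_derive s (1 : R) (fun r => x2_ (y r)) (x2_ y')].

Lemma is_derive_dot (R : realType) (s : R) (x : 'rV[R]_3) y y' :
  is_derive3 s y y' -> is_derive s (1 : R) (fun r => dot x (y r)) (dot x y').
Proof.
move=> [d0 d1 d2]; rewrite dotE; under eq_fun do rewrite dotE.
by apply: is_derive_eq; rewrite /GRing.scale/=; ring.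
Qed.

(** Uniform rotation on the sphere, with angular velocity w. *)
Definition rotating (R : realType) (w : 'rV[R]_3) (y : R -> 'rV[R]_3) : Prop :=
  forall s, sphere (y s) /\ is_derive3 s y (cross w (y s)).

Lemma norm_dot_cross (R : realType) (w x y : 'rV[R]_3) :
  sphere x -> sphere y -> `|dot x (cross w y)| <= 1 + dot w w.
Proof.
move=> /sphereE xx /sphereE yy.
have := dot_ge0 (cross x (cross w y)); have := dot_cross x (cross w y).
have := dot_cross w y; rewrite xx yy => h1 h2 h3; have := dot_ge0 w => w0.
by rewrite ler_norml; nra.
Qed.

Lemma is_derive_colatitude (R : realType) (t p : R) :
  is_derive3 p (spherical t) (vec3 (cos p * cos t) (cos p * sin t) (- sin p)).
Proof.
split; rewrite vec3E; under eq_fun do rewrite sphericalE vec3E.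
- by apply: is_derive_eq; rewrite /GRing.scale/=; ring.
- by apply: is_derive_eq; rewrite /GRing.scale/=; ring.
- exact: is_derive_cos.
Qed.

Lemma is_derive_longitude (R : realType) (t p : R) :
  is_derive3 t (fun t => spherical t p) (vec3 (- (sin p * sin t)) (sin p * cos t) 0).
Proof.
split; rewrite vec3E; under eq_fun do rewrite sphericalE vec3E.
- by apply: is_derive_eq; rewrite /GRing.scale/=; ring.
- by apply: is_derive_eq; rewrite /GRing.scale/=; ring.
- exact: is_derive_cst.
Qed.

Section divergence.
Variables (R : realType) (H Hu Hv : R -> R -> R) (M : R).
Hypothesis C1H : C1_square H Hu Hv M.
Variables (w : 'rV[R]_3).

Let dp (t p : R) : 'rV[R]_3 := vec3 (cos p * cos t) (cos p * sin t) (- sin p).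
Let dt (t p : R) : 'rV[R]_3 := vec3 (- (sin p * sin t)) (sin p * cos t) 0.

(* Since <s, w x y> = <s x w, y>, the inner product with a rotating y changes as
   under the tangent field s x w; sin p times this field is a d/dp + b d/dt. *)
Let a0 (t : R) := x0_ w * sin t - x1_ w * cos t.
Let b0 (t : R) := x0_ w * cos t + x1_ w * sin t.
Let a (t p : R) := sin p * a0 t.
Let b (t p : R) := cos p * b0 t - x2_ w * sin p.

Let field_decomposition (y : 'rV[R]_3) t p :
  dot (spherical t p) (cross w y) * sin p =
  a t p * dot (dp t p) y + b t p * dot (dt t p) y.
Proof.
have c2 : cos t ^+ 2 = 1 - sin t ^+ 2 by have := cos2Dsin2 t; lra.
rewrite !dotE sphericalE /dp /dt /a /b /a0 /b0 !vec3E; apply/eqP.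
rewrite -subr_eq0; apply/eqP.
set st := sin t in c2 *; set ct := cos t in c2 *.
ring: c2.
Qed.

Let U (y : 'rV[R]_3) (q : R * R) := dot (spherical q.1 q.2) y.

Let continuousU y : continuous (U y).
Proof. exact: scont_dot. Qed.

Let U_le1 y q : sphere y -> `|U y q| <= 1.
Proof. by move=> Sy; apply: norm_dot_le1 => //; exact: sphere_spherical. Qed.

Let continuous_dp y : continuous (fun q : R * R => dot (dp q.1 q.2) y).
Proof.
under eq_fun do rewrite /dp dotE !vec3E.
move=> q; have [c1 s1] := (@continuous_cos1 R q, @continuous_sin1 R q).
have [c2 s2] := (@continuous_cos2 R q, @continuous_sin2 R q).
apply: cvgD; first apply: cvgD; apply: cvgM; try exact: cvg_cst.
- by apply: cvgM; [exact: c2|exact: c1].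
- by apply: cvgM; [exact: c2|exact: s1].
- by apply: cvgN; exact: s2.
Qed.

Let continuous_dt y : continuous (fun q : R * R => dot (dt q.1 q.2) y).
Proof.
under eq_fun do rewrite /dt dotE !vec3E.
move=> q; have [c1 s1] := (@continuous_cos1 R q, @continuous_sin1 R q).
have [c2 s2] := (@continuous_cos2 R q, @continuous_sin2 R q).
apply: cvgD; first apply: cvgD; apply: cvgM; try exact: cvg_cst.
- by apply: cvgN; apply: cvgM; [exact: s2|exact: s1].
- by apply: cvgM; [exact: s2|exact: c1].
Qed.

Let continuous_a0 : continuous (fun q : R * R => a0 q.1).
Proof.
move=> q; apply: cvgB; apply: cvgM; try exact: cvg_cst.
- exact: continuous_sin1.
- exact: continuous_cos1.
Qed.

Let continuous_b0 : continuous (fun q : R * R => b0 q.1).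
Proof.
move=> q; apply: cvgD; apply: cvgM; try exact: cvg_cst.
- exact: continuous_cos1.
- exact: continuous_sin1.
Qed.

Let continuous_a : continuous (fun q : R * R => a q.1 q.2).
Proof.
by move=> q; apply: cvgM; [exact: continuous_sin2|exact: continuous_a0].
Qed.

Let continuous_b : continuous (fun q : R * R => b q.1 q.2).
Proof.
move=> q; apply: cvgB; apply: cvgM.
- exact: continuous_cos2.
- exact: continuous_b0.
- exact: cvg_cst.
- exact: continuous_sin2.
Qed.

Variables y z : 'rV[R]_3.
Hypotheses (Sy : sphere y) (Sz : sphere z).

Let G (q : R * R) := H (U y q) (U z q).
Let Gp (q : R * R) := Hu (U y q) (U z q) * dot (dp q.1 q.2) y +
                      Hv (U y q) (U z q) * dot (dp q.1 q.2) z.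
Let Gt (q : R * R) := Hu (U y q) (U z q) * dot (dt q.1 q.2) y +
                      Hv (U y q) (U z q) * dot (dt q.1 q.2) z.

Let continuous_G : [/\ continuous G, continuous Gp & continuous Gt].
Proof.
have [_ /(_ (U y) (U z) (@continuousU y) (@continuousU z))] := C1H.
move=> /(_ (fun q => @U_le1 y q Sy) (fun q => @U_le1 z q Sz)) [cH cHu cHv] _.
split=> // q; apply: cvgD; apply: cvgM.
- exact: cHu.
- exact: continuous_dp.
- exact: cHv.
- exact: continuous_dp.
- exact: cHu.
- exact: continuous_dt.
- exact: cHv.
- exact: continuous_dt.
Qed.

Let P (q : R * R) := cos q.2 * a0 q.1 * G q + a q.1 q.2 * Gp q.
Let Q (q : R * R) := - (cos q.2 * a0 q.1) * G q + b q.1 q.2 * Gt q.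

Let continuous_P : continuous P.
Proof.
have [cG cGp _] := continuous_G.
move=> q; apply: cvgD; apply: cvgM; last exact: cGp.
- by apply: cvgM; [exact: continuous_cos2|exact: continuous_a0].
- exact: cG.
- exact: continuous_a.
Qed.

Let continuous_Q : continuous Q.
Proof.
have [cG _ cGt] := continuous_G.
move=> q; apply: cvgD; apply: cvgM; last exact: cGt.
- by apply: cvgN; apply: cvgM; [exact: continuous_cos2|exact: continuous_a0].
- exact: cG.
- exact: continuous_b.
Qed.

Let int_P t : \int[@lebesgue_measure R]_(p in `[0, pi]) P (t, p) = 0.
Proof.
transitivity (a t pi * G (t, pi) - a t 0 * G (t, 0)); last first.
  by rewrite /a sinpi sin0 !mul0r subrr.
apply: (@Rintegral_FTC2 R 0 pi _ (fun p => a t p * G (t, p)) (@pi_gt0 R)).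
- exact: continuous_pair1.
- move=> p _.
  have [chain _ _] := C1H.
  have dG : is_derive p (1 : R) (fun p => G (t, p)) (Gp (t, p)).
    apply: chain; rewrite -?/(U _ (t, p)) ?U_le1//;
      under eq_fun do rewrite /U dotC; rewrite dotC;
      apply: is_derive_dot; exact: is_derive_colatitude.
  have da : is_derive p (1 : R) (a t) (cos p * a0 t).
    by apply: is_derive_eq; rewrite /GRing.scale/=; ring.
  apply: is_derive_eq; rewrite /P /GRing.scale/=; ring.
Qed.

Let int_Q p : \int[@lebesgue_measure R]_(t in `[0, 2 * pi]) Q (t, p) = 0.
Proof.
have pi2 : 0 < 2 * pi :> R by have := @pi_gt0 R; lra.
transitivity (b (2 * pi) p * G (2 * pi, p) - b 0 p * G (0, p)); last first.
  have E : 2 * pi = 0 + pi *+ 2 :> R by ring.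
  by rewrite /b /b0 /G /U/= !sphericalE E cosD2pi sinD2pi subrr.
apply: (@Rintegral_FTC2 R 0 (2 * pi) _ (fun t => b t p * G (t, p)) pi2).
- exact: continuous_pair2.
- move=> t _.
  have [chain _ _] := C1H.
  have dG : is_derive t (1 : R) (fun t => G (t, p)) (Gt (t, p)).
    apply: chain; rewrite -?/(U _ (t, p)) ?U_le1//;
      under eq_fun do rewrite /U dotC; rewrite dotC;
      apply: is_derive_dot; exact: is_derive_longitude.
  have db : is_derive t (1 : R) (fun t => b t p) (- (cos p * a0 t)).
    by apply: is_derive_eq; rewrite /a0 /GRing.scale/=; ring.
  apply: is_derive_eq; rewrite /Q /GRing.scale/=; ring.
Qed.

(** The derivative of the integrand along the rotation is a divergence in the
    (longitude, colatitude) rectangle: its flux through the sides p = 0 and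
    p = pi vanishes, and those through t = 0 and t = 2 pi cancel. *)
Lemma Rintegral_rotation_field :
  \int[leb2 R]_(q in srect R)
    ((Hu (U y q) (U z q) * dot (spherical q.1 q.2) (cross w y) +
      Hv (U y q) (U z q) * dot (spherical q.1 q.2) (cross w z)) * sin q.2) = 0.
Proof.
transitivity (\int[leb2 R]_(q in srect R) (P q + Q q)).
  apply: eq_Rintegral => q _.
  rewrite mulrDl -!mulrA !field_decomposition /P /Q /Gp /Gt; ring.
have p0 := @pi_ge0 R; have pp0 := @twopi_ge0 R.
rewrite RintegralD; last 3 first.
- exact: measurable_rect.
- exact: integrable_rect.
- exact: integrable_rect.
rewrite (Rintegral_rect pp0 p0 continuous_P) (Rintegral_rect_swap pp0 p0 continuous_Q).
by rewrite (Rintegral_eq0 0 (2 * pi) int_P) (Rintegral_eq0 0 pi int_Q) addr0.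
Qed.

End divergence.

(** Differentiation under the integral sign: by [Rintegral_rotation_field] the
    derivative with respect to the angle of rotation vanishes. *)
Lemma sphere_integral_rotating (R : realType) (H Hu Hv : R -> R -> R) (M : R)
    (w : 'rV[R]_3) (y z : R -> 'rV[R]_3) :
  C1_square H Hu Hv M -> rotating w y -> rotating w z ->
  forall s, sphere_integral (fun x => H (dot x (y s)) (dot x (z s))) =
            sphere_integral (fun x => H (dot x (y 0)) (dot x (z 0))).
Proof.
move=> C1H ry rz; have [chain cont bound] := C1H.
pose f (s : R) (q : R * R) :=
  H (dot (spherical q.1 q.2) (y s)) (dot (spherical q.1 q.2) (z s)) * sin q.2.
pose df (s : R) (q : R * R) :=
  (Hu (dot (spherical q.1 q.2) (y s)) (dot (spherical q.1 q.2) (z s)) *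
     dot (spherical q.1 q.2) (cross w (y s)) +
   Hv (dot (spherical q.1 q.2) (y s)) (dot (spherical q.1 q.2) (z s)) *
     dot (spherical q.1 q.2) (cross w (z s))) * sin q.2.
have le1 (v : 'rV[R]_3) q : sphere v -> `|dot (spherical q.1 q.2) v| <= 1.
  by move=> Su; apply: norm_dot_le1 => //; exact: sphere_spherical.
have dfP s q : is_derive s (1 : R) (f^~ q) (df s q).
  have [Sy dy] := ry s; have [Sz dz] := rz s.
  have := is_derive_dot (spherical q.1 q.2) dy.
  have := is_derive_dot (spherical q.1 q.2) dz => dz' dy'.
  have dH := chain _ _ _ _ _ dy' dz' (le1 _ _ Sy) (le1 _ _ Sz).
  apply: (is_derive_eq (is_deriveM dH (is_derive_cst (sin q.2) s 1))).
  by rewrite /df /GRing.scale/= mulr0 add0r mulrC.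
pose A s := \int[leb2 R]_(q in srect R) f s q.
have intf s : (leb2 R).-integrable (srect R) (EFin \o f s).
  apply: integrable_rect; [exact: twopi_ge0|exact: pi_ge0|].
  have [Sy _] := ry s; have [Sz _] := rz s.
  have [cH _ _] := cont _ _ (@scont_dot R (y s)) (@scont_dot R (z s))
     (fun q => le1 _ q Sy) (fun q => le1 _ q Sz).
  by move=> q; apply: cvgM; [exact: cH|exact: continuous_sin2].
pose K := 2 * M * (1 + dot w w).
have df_le s q : `|partial1of2 f s q| <= `|K|.
  rewrite partial1of2E; have [_ ->] := dfP s q.
  apply: (le_trans _ (ler_norm K)); rewrite normrM.
  have [Sy _] := ry s; have [Sz _] := rz s.
  have Sq := sphere_spherical q.1 q.2.
  have [bu bv] := bound _ _ (le1 _ q Sy) (le1 _ q Sz).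
  have by_ := norm_dot_cross w Sq Sy; have bz := norm_dot_cross w Sq Sz.
  have s1 : `|sin q.2| <= 1 by rewrite ler_norml sin_geN1 sin_le1.
  apply: le_trans (ler_wpM2l (normr_ge0 _) s1) _; rewrite mulr1.
  apply: le_trans (ler_normD _ _) _; rewrite !normrM /K.
  have M0 : 0 <= M by exact: le_trans bu.
  have := ler_pM (normr_ge0 _) (normr_ge0 _) bu by_.
  have := ler_pM (normr_ge0 _) (normr_ge0 _) bv bz; lra.
have intK : (leb2 R).-integrable (srect R) (EFin \o cst `|K|).
  apply: integrable_rect; [exact: twopi_ge0|exact: pi_ge0|].
  by move=> q; exact: cvg_cst.
have dA (s : R) : is_derive s (1 : R) A 0.
  have Is : `]s - 1, s + 1[%classic s by rewrite /= in_itv/=; lra.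
  have mD := @measurable_rect R 0 (2 * pi) 0 pi.
  have der x q : `]s - 1, s + 1[%classic x -> srect R q -> derivable (f^~ q) x 1.
    by move=> _ _; have [] := dfP x q.
  split.
    exact: (@derivable_under_integral R _ _ (leb2 R) f (srect R) mD s
      (s - 1) (s + 1) Is (fun x _ => intf x) der (cst `|K|)
      (fun=> normr_ge0 _) intK (fun x q _ _ => df_le x q)).
  rewrite -derive1E.
  rewrite (@differentiation_under_integral R _ _ (leb2 R) f (srect R) mD s
      (s - 1) (s + 1) Is (fun x _ => intf x) der (cst `|K|)
      (fun=> normr_ge0 _) intK (fun x q _ _ => df_le x q)).
  have [Sy _] := ry s; have [Sz _] := rz s.
  rewrite -[RHS](Rintegral_rotation_field C1H w Sy Sz).
  apply: eq_Rintegral => q _; rewrite partial1of2E.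
  by have [_ ->] := dfP s q.
by move=> s; exact: is_derive_0_is_cst.
Qed.

Section rotations.
Variable R : realType.
Implicit Types y z : 'rV[R]_3.

Definition rotZ (s : R) y : 'rV[R]_3 :=
  vec3 (cos s * x0_ y - sin s * x1_ y) (sin s * x0_ y + cos s * x1_ y) (x2_ y).

Definition rotX (s : R) y : 'rV[R]_3 :=
  vec3 (x0_ y) (cos s * x1_ y - sin s * x2_ y) (sin s * x1_ y + cos s * x2_ y).

Lemma dot_rotZ s y z : dot (rotZ s y) (rotZ s z) = dot y z.
Proof.
have c2 : cos s ^+ 2 = 1 - sin s ^+ 2 by have := cos2Dsin2 s; lra.
by rewrite !dotE !vec3E; ring: c2.
Qed.

Lemma dot_rotX s y z : dot (rotX s y) (rotX s z) = dot y z.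
Proof.
have c2 : cos s ^+ 2 = 1 - sin s ^+ 2 by have := cos2Dsin2 s; lra.
by rewrite !dotE !vec3E; ring: c2.
Qed.

Lemma sphere_rotZ s y : sphere y -> sphere (rotZ s y).
Proof. by move=> /sphereE Sy; apply/sphereE; rewrite dot_rotZ. Qed.

Lemma sphere_rotX s y : sphere y -> sphere (rotX s y).
Proof. by move=> /sphereE Sy; apply/sphereE; rewrite dot_rotX. Qed.

Lemma rotating_rotZ y : sphere y -> rotating (vec3 0 0 1) (rotZ^~ y).
Proof.
move=> Sy s; split; first exact: sphere_rotZ.
split; rewrite !vec3E; under eq_fun do rewrite vec3E.
- by apply: is_derive_eq; rewrite /GRing.scale/=; ring.
- by apply: is_derive_eq; rewrite /GRing.scale/=; ring.
- by rewrite !mul0r subrr; exact: is_derive_cst.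
Qed.

Lemma rotating_rotX y : sphere y -> rotating (vec3 1 0 0) (rotX^~ y).
Proof.
move=> Sy s; split; first exact: sphere_rotX.
split; rewrite !vec3E; under eq_fun do rewrite vec3E.
- by rewrite !mul0r subrr; exact: is_derive_cst.
- by apply: is_derive_eq; rewrite /GRing.scale/=; ring.
- by apply: is_derive_eq; rewrite /GRing.scale/=; ring.
Qed.

Lemma rotZ0 y : rotZ 0 y = y.
Proof. by rewrite [RHS]vec3_eta /rotZ cos0 sin0; congr vec3; ring. Qed.

Lemma rotX0 y : rotX 0 y = y.
Proof. by rewrite [RHS]vec3_eta /rotX cos0 sin0; congr vec3; ring. Qed.

Lemma rotZ_spherical s t p : rotZ s (spherical t p) = spherical (t + s) p.
Proof. by rewrite !sphericalE /rotZ !vec3E cosD sinD; congr vec3; ring. Qed.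

Definition north : 'rV[R]_3 := spherical 0 0.

Lemma sphere_north : sphere north.
Proof. exact: sphere_spherical. Qed.

Lemma northE : north = vec3 0 0 1.
Proof. by rewrite /north sphericalE sin0 cos0 !mul0r. Qed.

(** Two rotations bring y to the north pole, and a third one brings the image
    of z to longitude 0, where only the angle between y and z is left. *)
Lemma rotation_normal_form (T : Type) (Phi : 'rV[R]_3 -> 'rV[R]_3 -> T) :
  (forall s y z, sphere y -> sphere z -> Phi (rotZ s y) (rotZ s z) = Phi y z) ->
  (forall s y z, sphere y -> sphere z -> Phi (rotX s y) (rotX s z) = Phi y z) ->
  forall y z, sphere y -> sphere z ->
    Phi y z = Phi north (spherical 0 (acos (dot y z))).
Proof.
move=> invZ invX y z Sy Sz.
have [t [p [_ _ yE]]] := spherical_surj Sy.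
pose s := pi / 2 - t.
rewrite -(invZ s) // -(invX p); [|exact: sphere_rotZ..].
have -> : rotX p (rotZ s y) = north.
  rewrite yE rotZ_spherical /s addrC subrK sphericalE northE /rotX !vec3E.
  rewrite cos_pihalf sin_pihalf; congr vec3; [ring..|].
  by have := cos2Dsin2 p; lra.
set z' := rotX p (rotZ s z).
have Sz' : sphere z' by apply: sphere_rotX; exact: sphere_rotZ.
have Nz' : dot north z' = dot y z.
  rewrite -[RHS](dot_rotZ s) -[RHS](dot_rotX p) -/z'; congr dot.
  rewrite yE rotZ_spherical /s addrC subrK sphericalE northE /rotX !vec3E.
  rewrite cos_pihalf sin_pihalf; congr vec3; [ring..|].
  by have := cos2Dsin2 p; lra.
have [t' [p' [_ p'_itv z'E]]] := spherical_surj Sz'.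
rewrite -(invZ (- t')) //; last exact: sphere_north.
rewrite -Nz' z'E rotZ_spherical subrr.
have -> : dot north (spherical t' p') = cos p'.
  by rewrite northE sphericalE dotE !vec3E; ring.
rewrite cosK ?in_itv//; congr Phi.
by rewrite northE /rotZ !vec3E; congr vec3; ring.
Qed.

End rotations.

Section smoothing.
Variables (R : realType) (k th e : R).
Hypothesis e01 : 0 < e < 1.

Let r : R := 1 - e.
Let W (u v : R) := acos (r * u) - k * acos (r * v) - th.
Let D (u v : R) := Num.sqrt (W u v ^+ 2 + e ^+ 2).
Let da (u : R) := - (Num.sqrt (1 - (r * u) ^+ 2))^-1 * r.
Let Hu (u v : R) := W u v / D u v * da u.
Let Hv (u v : R) := W u v / D u v * (- k * da v).

Let r_itv : 0 < r < 1. Proof. by have [? ?] := andP e01; rewrite /r; apply/andP; split; lra. Qed.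

Let ru_itv u : `|u| <= 1 -> -1 < r * u < 1.
Proof.
have [r0 r1] := andP r_itv; move=> u1; rewrite -ltr_norml normrM gtr0_norm//.
by apply: le_lt_trans r1; rewrite ler_piMr// ltW.
Qed.

Let We_gt0 u v : 0 < W u v ^+ 2 + e ^+ 2.
Proof. by rewrite ltr_wpDl ?sqr_ge0// exprn_gt0//; case/andP: e01. Qed.

Let D_gt0 u v : 0 < D u v. Proof. by rewrite sqrtr_gt0. Qed.

Let sq_gt0 u : `|u| <= 1 -> 0 < 1 - (r * u) ^+ 2.
Proof. by move=> /ru_itv ?; nra. Qed.

Let m := (Num.sqrt (1 - r ^+ 2))^-1.

Let da_le u : `|u| <= 1 -> `|da u| <= m.
Proof.
move=> u1; have sq := sq_gt0 u1; have [r0 r1] := andP r_itv.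
have h0 : 0 < 1 - r ^+ 2 by nra.
have le : Num.sqrt (1 - r ^+ 2) <= Num.sqrt (1 - (r * u) ^+ 2).
  apply: ler_wsqrtr; move: u1; rewrite ler_norml => /andP[? ?].
  rewrite lerD2l lerN2 exprMn ler_piMr ?sqr_ge0//; nra.
rewrite /da normrM normrN (ger0_norm (ltW r0)).
rewrite ger0_norm ?invr_ge0 ?sqrtr_ge0//.
have le' : (Num.sqrt (1 - (r * u) ^+ 2))^-1 <= m.
  by rewrite /m lef_pV2 ?posrE ?sqrtr_gt0.
apply: le_trans le'; rewrite ler_piMr ?(ltW r1)// invr_ge0 sqrtr_ge0//.
Qed.

Let W_le_D u v : `|W u v / D u v| <= 1.
Proof.
rewrite normrM normfV (gtr0_norm (D_gt0 u v)) ler_pdivrMr// mul1r.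
by rewrite -sqrtr_sqr /D; apply: ler_wsqrtr; rewrite lerDl sqr_ge0.
Qed.

Let is_derive_acosr (u : R -> R) (s u' : R) : is_derive s (1 : R) u u' ->
  `|u s| <= 1 -> is_derive s (1 : R) (fun x => acos (r * u x)) (da (u s) * u').
Proof.
move=> du u1; have dac := is_derive1_acos (ru_itv u1).
have dru : is_derive s (1 : R) (fun x => r * u x) (r * u').
  by apply: is_derive_eq; rewrite /GRing.scale/=; ring.
apply: (is_derive_eq (@is_derive1_comp R _ (fun x => r * u x) s _ _ dac dru)).
by rewrite /da mulrA.
Qed.

Let continuous_acosr (u : R * R -> R) : continuous u ->
  (forall z, `|u z| <= 1) -> continuous (fun z => acos (r * u z)).
Proof.
move=> cu u1 z; apply: (@continuous_comp _ _ _ (fun z => r * u z) (@acos R)).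
  by apply: cvgM; [exact: cvg_cst|exact: cu].
exact: continuous_acos (ru_itv (u1 z)).
Qed.

Let continuous_da (u : R * R -> R) : continuous u ->
  (forall z, `|u z| <= 1) -> continuous (fun z => da (u z)).
Proof.
move=> cu u1 z; apply: cvgM; last exact: cvg_cst.
apply: cvgN; apply: cvgV; first by rewrite gt_eqF// sqrtr_gt0 sq_gt0.
apply: (@continuous_comp _ _ _ (fun z => 1 - (r * u z) ^+ 2) (@Num.sqrt R));
  last exact: sqrt_continuous.
apply: cvgB; first exact: cvg_cst.
have cru : {for z, continuous (fun z => r * u z)}.
  by apply: cvgM; [exact: cvg_cst|exact: cu].
by apply: cvgM; exact: cru.
Qed.

(** Neither arccos at the end points nor the absolute value at 0 is
    differentiable. The arguments of arccos are contracted by the factor 1 - e, and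
    |w| is replaced by sqrt (w ^ 2 + e ^ 2). *)
Lemma C1_square_smoothing : C1_square D Hu Hv ((1 + `|k|) * m).
Proof.
have m0 : 0 <= m by rewrite invr_ge0 sqrtr_ge0.
split.
- move=> u v s u' v' du dv u1 v1.
  have dau := is_derive_acosr du u1; have dav := is_derive_acosr dv v1.
  have dW : is_derive s (1 : R) (fun x => W (u x) (v x) ^+ 2 + e ^+ 2)
     (2 * W (u s) (v s) * (da (u s) * u' - k * (da (v s) * v'))).
    by apply: is_derive_eq; rewrite /W /GRing.scale/=; ring.
  have dsq := is_derive1_sqrt (We_gt0 (u s) (v s)).
  apply: (is_derive_eq (@is_derive1_comp R _
     (fun x => W (u x) (v x) ^+ 2 + e ^+ 2) s _ _ dsq dW)).
  rewrite -/(D (u s) (v s)) /Hu /Hv.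
  by field; rewrite gt_eqF.
- move=> u v cu cv u1 v1.
  have cW : continuous (fun z => W (u z) (v z)).
    move=> z; apply: cvgB; last exact: cvg_cst.
    apply: cvgB; first exact: continuous_acosr.
    by apply: cvgM; [exact: cvg_cst|exact: continuous_acosr].
  have cD : continuous (fun z => D (u z) (v z)).
    move=> z; apply: (@continuous_comp _ _ _
      (fun z => W (u z) (v z) ^+ 2 + e ^+ 2) (@Num.sqrt R));
      last exact: sqrt_continuous.
    by apply: cvgD; [apply: cvgM; exact: cW|exact: cvg_cst].
  have cWD : continuous (fun z => W (u z) (v z) / D (u z) (v z)).
    by move=> z; apply: cvgM; [exact: cW|apply: cvgV; [rewrite gt_eqF|exact: cD]].
  split=> //.
  + by move=> z; apply: cvgM; [exact: cWD|exact: continuous_da].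
  + move=> z; apply: cvgM; first exact: cWD.
    by apply: cvgM; [exact: cvg_cst|exact: continuous_da].
- move=> u v u1 v1; have dau := da_le u1; have dav := da_le v1.
  have WD X : `|W u v / D u v * X| <= `|X|.
    by rewrite normrM ler_piMl// W_le_D.
  split; apply: le_trans (WD _) _.
  + by apply: le_trans dau _; rewrite mulrDl mul1r lerDl mulr_ge0.
  + rewrite normrM normrN mulrDl mul1r.
    by apply: (@le_trans _ _ (`|k| * m)); [rewrite ler_wpM2l|rewrite lerDr].
Qed.

Lemma smoothing_close u v : `|u| <= 1 -> `|v| <= 1 ->
  `|D u v - `|acos u - k * acos v - th| | <=
    e + (1 + `|k|) * Num.sqrt (18 * e).
Proof.
move=> u1 v1; have [e0 e1] := andP e01.
have acos_close x : `|x| <= 1 -> `|acos (r * x) - acos x| <= Num.sqrt (18 * e).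
  move=> x1; apply: le_trans (acos_dist _ x1) _.
    by have := ru_itv x1; rewrite ler_norml; lra.
  apply: ler_wsqrtr; rewrite ler_wpM2l//.
  have -> : r * x - x = - (e * x) by rewrite /r; ring.
  by rewrite normrN normrM (gtr0_norm e0) ler_piMr// ltW.
have au := acos_close _ u1; have av := acos_close _ v1.
set w := acos u - k * acos v - th.
have wW : `|W u v - w| <= (1 + `|k|) * Num.sqrt (18 * e).
  have -> : W u v - w =
    (acos (r * u) - acos u) - k * (acos (r * v) - acos v) by rewrite /W /w; ring.
  apply: le_trans (ler_normB _ _) _.
  set S := Num.sqrt _ in au av *.
  have -> : (1 + `|k|) * S = S + `|k| * S by ring.
  by apply: lerD => //; rewrite normrM ler_wpM2l.
have WD : `|D u v - `|W u v| | <= e.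
  have h : D u v <= `|W u v| + e.
    have h0 : 0 <= `|W u v| + e by rewrite addr_ge0// ltW.
    rewrite -(ger0_norm h0) -sqrtr_sqr /D; apply: ler_wsqrtr.
    have := real_normK (num_real (W u v)); have := normr_ge0 (W u v).
    move: `|W u v| => x x0 <-; nra.
  have h' : `|W u v| <= D u v.
    by rewrite -sqrtr_sqr /D; apply: ler_wsqrtr; rewrite lerDl sqr_ge0.
  by rewrite ler_norml; lra.
have -> : D u v - `|w| = (D u v - `|W u v|) + (`|W u v| - `|w|) by ring.
apply: le_trans (ler_normD _ _) _; apply: lerD => //.
exact: le_trans (ler_dist_dist _ _) wW.
Qed.

End smoothing.

Lemma sphere_integral_close (R : realType) (f g : 'rV[R]_3 -> R) (c : R) :
  scont f -> scont g -> (forall x, sphere x -> `|f x - g x| <= c) ->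
  `|sphere_integral f - sphere_integral g| <= 4 * pi * c.
Proof.
move=> cf cg fg; rewrite -sphere_integralB// -sphere_integral_cst ler_norml.
apply/andP; split.
- have -> : - sphere_integral (fun=> c) = sphere_integral (fun=> - c) :> R.
    by rewrite !sphere_integral_cst mulrN.
  apply: le_sphere_integral; [exact: scont_cst|exact: scontB|].
  by move=> x /fg; rewrite ler_norml => /andP[].
- apply: le_sphere_integral; [exact: scontB|exact: scont_cst|].
  by move=> x /fg; rewrite ler_norml => /andP[].
Qed.

Lemma scont_acos (R : realType) (y : 'rV[R]_3) :
  sphere y -> scont (fun x => acos (dot x y)).
Proof.
move=> Sy; apply: scont_lipschitz => x x' Sx Sx'.
by rewrite (dotC x y) (dotC x' y); exact: geodesic_triangle.
Qed.

Lemma eq_of_close (R : realType) (a b C : R) :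
  (forall d, 0 < d < 1 -> `|a - b| <= C * d) -> a = b.
Proof.
move=> h; apply/eqP; rewrite -subr_eq0 -normr_le0; apply/ler_addgt0Pl => e e0.
rewrite addr0; pose d := Num.min (1 / 2) (e / (1 + `|C|)).
have C0 : 0 < 1 + `|C| by rewrite ltr_wpDr.
have d0 : 0 < d by rewrite /d lt_min divr_gt0// divr_gt0.
have d1 : d < 1 by rewrite /d gt_min; apply/orP; left; lra.
apply: le_trans (h d _) _; first by rewrite d0.
apply: (@le_trans _ _ ((1 + `|C|) * d)).
  by rewrite ler_wpM2r ?ltW//; have := ler_norm C; lra.
by rewrite mulrC -ler_pdivlMr// /d ge_min lexx orbT.
Qed.

Section invariance.
Variables (R : realType) (k th : R).

Let f (y z x : 'rV[R]_3) := `|acos (dot x y) - k * acos (dot x z) - th|.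
Let Phi (y z : 'rV[R]_3) := sphere_integral (f y z).

Let scont_f y z : sphere y -> sphere z -> scont (f y z).
Proof.
move=> Sy Sz; apply: scont_norm; apply: scontB; last exact: scont_cst.
by apply: scontB; [exact: scont_acos|apply: scontZ; exact: scont_acos].
Qed.

Let Phi_rotating (w : 'rV[R]_3) (y z : R -> 'rV[R]_3) s :
  rotating w y -> rotating w z -> Phi (y s) (z s) = Phi (y 0) (z 0).
Proof.
move=> ry rz; apply: (@eq_of_close _ _ _ (8 * pi * (2 + `|k|))) => d d01.
pose e := d ^+ 2 / 18.
have e01 : 0 < e < 1 by rewrite /e; nra.
pose g (y z x : 'rV[R]_3) := Num.sqrt ((acos ((1 - e) * dot x y) -
   k * acos ((1 - e) * dot x z) - th) ^+ 2 + e ^+ 2).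
have C1 := C1_square_smoothing k th e01.
have scont_g y' z' : sphere y' -> sphere z' -> scont (g y' z').
  move=> Sy Sz; have [_ cont _] := C1.
  have [] // := cont _ _ (@scont_dot R y') (@scont_dot R z').
  - by move=> q; apply: norm_dot_le1 => //; exact: sphere_spherical.
  - by move=> q; apply: norm_dot_le1 => //; exact: sphere_spherical.
have close t : `|sphere_integral (g (y t) (z t)) - Phi (y t) (z t)| <=
    4 * pi * ((2 + `|k|) * d).
  have [Sy _] := ry t; have [Sz _] := rz t.
  apply: sphere_integral_close; [exact: scont_g|exact: scont_f|] => x Sx.
  apply: le_trans (smoothing_close k th e01 (norm_dot_le1 Sx Sy)
    (norm_dot_le1 Sx Sz)) _.
  have -> : 18 * e = d ^+ 2 by rewrite /e; field.
  have [d0 d1] := andP d01.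
  rewrite sqrtr_sqr (gtr0_norm d0) -subr_ge0.
  have -> : (2 + `|k|) * d - (e + (1 + `|k|) * d) = d - e by ring.
  by rewrite /e; nra.
have E := sphere_integral_rotating C1 ry rz s.
have := close s; have := close 0; rewrite /g E !ler_norml.
by move: (sphere_integral _) (Phi _ _) (Phi _ _) => A B C; clear; lra.
Qed.

(** Rotation invariance holds for the smoothings of the integrand and passes to
    their uniform limit; the case k = 0 serves for circles, k = 1 for arcs. *)
Lemma sphere_integral_acos_invariant y z : sphere y -> sphere z ->
  sphere_integral (fun x => `|acos (dot x y) - k * acos (dot x z) - th|) =
  sphere_integral (fun x => `|acos (dot x (north R)) -
    k * acos (dot x (spherical 0 (acos (dot y z)))) - th|).
Proof.
move=> Sy Sz; apply: (rotation_normal_form (Phi := Phi)) => //.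
- move=> s y' z' Sy' Sz'; rewrite -[y' in RHS]rotZ0 -[z' in RHS]rotZ0.
  exact: (Phi_rotating s (rotating_rotZ Sy') (rotating_rotZ Sz')).
- move=> s y' z' Sy' Sz'; rewrite -[y' in RHS]rotX0 -[z' in RHS]rotX0.
  exact: (Phi_rotating s (rotating_rotX Sy') (rotating_rotX Sz')).
Qed.

End invariance.

Lemma dot_north (R : realType) (t p : R) : dot (spherical t p) (north R) = cos p.
Proof. by rewrite northE sphericalE dotE !vec3E; ring. Qed.

(** * The two explicit spherical averages *)

Lemma Rintegral_split (R : realType) (a b c : R) (f : R -> R) :
  a < b -> b < c -> continuous f ->
  \int[@lebesgue_measure R]_(x in `[a, c]) f x =
  \int[@lebesgue_measure R]_(x in `[a, b]) f x +
  \int[@lebesgue_measure R]_(x in `[b, c]) f x.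
Proof.
move=> ab bc cf; have [F dF] := @exists_primitive R (a - 1) f cf.
have E x y : a <= x -> x < y ->
    \int[@lebesgue_measure R]_(x in `[x, y]) f x = F y - F x.
  by move=> ax xy; apply: Rintegral_FTC2 => // z /andP[xz _]; apply: dF; lra.
rewrite !E//; [ring|exact: ltW|exact: lt_trans bc].
Qed.

(** Piecewise evaluation: on the integration interval f need only agree with
    the function whose primitive is known. *)
Lemma Rintegral_FTC2_on (R : realType) (a b : R) (f g F : R -> R) : a < b ->
  continuous g -> (forall x : R, is_derive x (1 : R) F (g x)) ->
  (forall x, a <= x <= b -> f x = g x) ->
  \int[@lebesgue_measure R]_(x in `[a, b]) f x = F b - F a.
Proof.
move=> ab cg dF fg; rewrite -(Rintegral_FTC2 ab cg (fun x _ => dF x)).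
by apply: eq_Rintegral => x /[!inE]/=; rewrite in_itv/=; exact: fg.
Qed.

Lemma Rintegral_abs_sub_sin (R : realType) (th : R) : 0 < th < pi ->
  \int[@lebesgue_measure R]_(p in `[0, pi]) (`|p - th| * sin p) =
  pi - 2 * sin th.
Proof.
move=> /andP[th0 thpi].
have cs : continuous (fun p : R => (p - th) * sin p).
  move=> p; apply: cvgM; last exact: continuous_sin.
  by apply: cvgB; [exact: cvg_id|exact: cvg_cst].
have ca : continuous (fun p : R => `|p - th| * sin p).
  move=> p; apply: cvgM; last exact: continuous_sin.
  apply: (@cvg_norm _ R).
  by apply: cvgB; [exact: cvg_id|exact: cvg_cst].
pose F (p : R) := sin p - (p - th) * cos p.
have dF (p : R) : is_derive p (1 : R) F ((p - th) * sin p).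
  by apply: is_derive_eq; rewrite /GRing.scale/=; ring.
have dNF (p : R) : is_derive p (1 : R) (fun p => - F p) (- ((p - th) * sin p)).
  exact: is_deriveN.
rewrite (Rintegral_split th0 thpi ca).
rewrite (Rintegral_FTC2_on th0 _ dNF); last 2 first.
- by move=> p; apply: cvgN; exact: cs.
- by move=> p /andP[_ pth]; rewrite ler0_norm ?subr_le0// mulNr.
rewrite (Rintegral_FTC2_on thpi cs dF); last first.
  by move=> p /andP[thp _]; rewrite ger0_norm ?subr_ge0.
by rewrite /F subrr cospi sinpi sin0 cos0; ring.
Qed.

Lemma cos_le0 (R : realType) (x : R) : pi / 2 <= x <= 3 * pi / 2 -> cos x <= 0.
Proof.
move=> x_itv; rewrite -[x](subrK pi) cosDpi oppr_le0.
by apply: cos_ge0_pihalf; lra.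
Qed.

Lemma Rintegral_abs_cos (R : realType) :
  \int[@lebesgue_measure R]_(t in `[0, 2 * pi]) `|cos t| = 4.
Proof.
have p0 := @pi_gt0 R.
have ca : continuous (fun t : R => `|cos t|).
  by move=> t; apply: (@cvg_norm _ R); exact: continuous_cos.
have [h1 h2 h3] : [/\ 0 < pi / 2 :> R, pi / 2 < 3 * pi / 2 :> R &
  3 * pi / 2 < 2 * pi :> R] by split; lra.
rewrite (Rintegral_split h1 (lt_trans h2 h3) ca) (Rintegral_split h2 h3 ca).
have ds (t : R) : is_derive t (1 : R) sin (cos t) by exact: is_derive_sin.
have dNs (t : R) : is_derive t (1 : R) (fun t => - sin t) (- cos t).
  exact: is_deriveN.
rewrite (Rintegral_FTC2_on h1 (@continuous_cos R) ds); last first.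
  by move=> t t_itv; rewrite ger0_norm// cos_ge0_pihalf//; lra.
rewrite (Rintegral_FTC2_on h2 _ dNs); last 2 first.
- by move=> t; apply: cvgN; exact: continuous_cos.
- by move=> t t_itv; rewrite ler0_norm// cos_le0.
rewrite (Rintegral_FTC2_on h3 (@continuous_cos R) ds); last first.
  move=> t t_itv; rewrite ger0_norm// -[t](subrK (pi *+ 2)) cosD2pi.
  by apply: cos_ge0_pihalf; rewrite -mulr_natl; lra.
have -> : 3 * pi / 2 = pi / 2 + pi :> R by field.
have -> : 2 * pi = 0 + pi *+ 2 :> R by ring.
by rewrite sinDpi sinD2pi sin0 sin_pihalf; ring.
Qed.

(** By invariance c may be taken to be the north pole, where arccos <x, c> is the
    colatitude of x. *)
Lemma sphere_integral_zonal (R : realType) (c : 'rV[R]_3) (th : R) :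
  sphere c -> 0 < th < pi ->
  sphere_integral (fun x => `|acos (dot x c) - th|) =
  2 * pi * (pi - 2 * sin th).
Proof.
move=> Sc th_itv.
have := sphere_integral_acos_invariant 0 th Sc Sc.
rewrite (eq_sphere_integral (g := fun x => `|acos (dot x c) - th|)); last first.
  by move=> x _; rewrite mul0r subr0.
move=> ->.
pose f (x : 'rV[R]_3) := `|acos (dot x (north R)) - th|.
rewrite (eq_sphere_integral (g := f)); last first.
  by move=> x _; rewrite mul0r subr0.
have cf : scont f.
  apply: scont_norm; apply: scontB; last exact: scont_cst.
  by apply: scont_acos; exact: sphere_north.
rewrite (sphere_integral_colatitude
  (@continuous_pair1 R _ 0 (scont_integrand cf)) _ cf)/=; last first.
  by move=> t p; rewrite /f !dot_north.
rewrite -(Rintegral_abs_sub_sin th_itv); congr (_ * _).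
apply: eq_Rintegral => p /[!inE]/=; rewrite in_itv/= => p_itv.
by rewrite /f dot_north cosK ?in_itv.
Qed.

(** For 0 <= d <= pi, 4 pi times the mean over x of the change of the distance to
    x between the ends of an arc of length d. *)
Definition arc_integral (R : realType) (d : R) : R :=
  sphere_integral (fun x => `|acos (dot x (north R)) -
                              acos (dot x (spherical 0 d))|).

Lemma sphere_integral_acos_sub (R : realType) (y z : 'rV[R]_3) :
  sphere y -> sphere z ->
  sphere_integral (fun x => `|acos (dot x y) - acos (dot x z)|) =
  arc_integral (acos (dot y z)).
Proof.
move=> Sy Sz; have := sphere_integral_acos_invariant 1 0 Sy Sz.
rewrite (eq_sphere_integral
  (g := fun x => `|acos (dot x y) - acos (dot x z)|)); last first.
  by move=> x _; rewrite mul1r subr0.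
move=> ->; apply: eq_sphere_integral => x _; by rewrite mul1r subr0.
Qed.

Lemma acos_cos_le (R : realType) (d : R) : 0 <= d -> acos (cos d) <= d.
Proof.
move=> d0; have [dpi|pid] := leP d pi; first by rewrite cosK// in_itv/= d0.
by apply: le_trans (ltW pid); apply: acos_lepi; rewrite cos_geN1 cos_le1.
Qed.

(** First variation of the distance: leaving the pole in the direction of
    longitude 0 changes the distance to a point of longitude t at the rate - cos t. *)
Lemma cvg_acos_quotient (R : realType) (t p : R) : 0 < p < pi ->
  (acos (dot (spherical t p) (spherical 0 d)) - p) / d @[d --> (0 : R)^'+] -->
  - cos t.
Proof.
move=> p_itv; have s0 : 0 < sin p by exact: sin_gt0_pi.
pose q (d : R) := sin p * cos t * sin d + cos p * cos d.
have qE d : dot (spherical t p) (spherical 0 d) = q d.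
  by rewrite /q !sphericalE dotE !vec3E cos0 sin0; ring.
have q0 : q 0 = cos p by rewrite /q sin0 cos0; ring.
have dq : is_derive (0 : R) (1 : R) q (sin p * cos t).
  by apply: is_derive_eq; rewrite /GRing.scale/= sin0 cos0; ring.
have cp : -1 < q 0 < 1.
  by rewrite q0; have := cos2Dsin2 p; nra.
have dacos := is_derive1_acos cp.
have sq : Num.sqrt (1 - q 0 ^+ 2) = sin p.
  by rewrite q0 -sin2cos2 sqrtr_sqr gtr0_norm.
have dA : is_derive (0 : R) (1 : R) (fun d => acos (q d)) (- cos t).
  apply: (is_derive_eq (@is_derive1_comp R _ q 0 _ _ dacos dq)).
  by rewrite sq; field; rewrite gt_eqF.
have [der derE] := dA.
have {der} : (h^-1 *: (acos (q (h *: 1 + 0)) - acos (q 0)))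
    @[h --> (0 : R)^'] --> - cos t by rewrite -derE; exact: der.
move=> /cvg_dnbhs_at_right; apply: cvg_trans; apply: near_eq_cvg; near=> h.
rewrite qE q0 cosK ?in_itv/=; last by rewrite !ltW; lra.
by rewrite /GRing.scale/= mulr1 addr0 mulrC.
Unshelve. all: by end_near. Qed.

Lemma Rintegral_abs_cos_sin (R : realType) :
  \int[leb2 R]_(q in srect R) (`|cos q.1| * sin q.2) = 8.
Proof.
have cF : continuous (fun q : R * R => `|cos q.1| * sin q.2).
  move=> q; apply: cvgM; last exact: continuous_sin2.
  by apply: (@cvg_norm _ R); exact: continuous_cos1.
rewrite (Rintegral_rect (@twopi_ge0 R) (@pi_ge0 R) cF).
transitivity (\int[@lebesgue_measure R]_(t in `[0, 2 * pi]) (2 * `|cos t|)).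
  apply: eq_Rintegral => t _.
  have D (p : R) : is_derive p (1 : R) (fun p => - `|cos t| * cos p)
      (`|cos t| * sin p).
    by apply: is_derive_eq; rewrite /GRing.scale/=; ring.
  have cG : continuous (fun p : R => `|cos t| * sin p).
    by move=> p; apply: cvgM; [exact: cvg_cst|exact: continuous_sin].
  rewrite (Rintegral_FTC2_on (@pi_gt0 R) cG D)// cospi cos0; ring.
rewrite RintegralZl//; first by rewrite Rintegral_abs_cos; ring.
apply: integrable_itv => t; apply: (@cvg_norm _ R); exact: continuous_cos.
Qed.

Lemma arc_integrand_le (R : realType) (d : R) (x : 'rV[R]_3) : 0 < d -> sphere x ->
  `|acos (dot x (north R)) - acos (dot x (spherical 0 d))| <= d.
Proof.
move=> d0 Sx; have Sd := sphere_spherical 0 d.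
apply: le_trans (geodesic_triangle Sx (sphere_north R) Sd) _.
by rewrite dotC dot_north acos_cos_le// ltW.
Qed.

(** Dominated convergence: the rate of change of the distance to x along an arc
    leaving the pole in direction 0 tends to |cos t|, t the longitude of x. *)
Lemma cvg_arc_integral (R : realType) :
  arc_integral d / d @[d --> (0 : R)^'+] --> (8 : R).
Proof.
apply/cvg_at_rightP => u [u0 cu].
pose F d (q : R * R) := `|acos (dot (spherical q.1 q.2) (north R)) -
  acos (dot (spherical q.1 q.2) (spherical 0 d))| * sin q.2 / d.
pose F0 (q : R * R) := `|cos q.1| * sin q.2.
have Sn := sphere_north R.
have scf d : scont (fun x => `|acos (dot x (north R)) -
                              acos (dot x (spherical 0 d))|).
  apply: scont_norm; apply: scontB; apply: scont_acos => //.
  exact: sphere_spherical.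
have cF d : continuous (F d).
  by move=> q; apply: cvgM; [exact: (scont_integrand (scf d))|exact: cvg_cst].
have cF0 : continuous F0.
  move=> q; apply: cvgM; last exact: continuous_sin2.
  by apply: (@cvg_norm _ R); exact: continuous_cos1.
have FE d : arc_integral d / d = \int[leb2 R]_(q in srect R) F d q.
  rewrite RintegralZr//; first exact: measurable_rect.
  exact: (scont_integrable (scf d)).
have mD := @measurable_rect R 0 (2 * pi) 0 pi.
have dom d q : 0 < d -> srect R q -> `|F d q| <= 1.
  move=> d0 Dq; rewrite normrM normfV (gtr0_norm d0) ler_pdivrMr// mul1r.
  rewrite normrM normr_id; apply: le_trans (arc_integrand_le d0 (sphere_spherical q.1 q.2)).
  by rewrite ler_piMr// ler_norml sin_geN1 sin_le1.
have ptw q : srect R q -> F (u n) q @[n --> \oo] --> F0 q.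
  move=> Dq; have := Dq => -[_ /=]; rewrite in_itv/= => /andP[q0 qpi].
  have [s0|s0] := eqVneq (sin q.2) 0.
    rewrite /F0 s0 mulr0 /F s0; under eq_fun do rewrite mulr0 mul0r.
    exact: cvg_cst.
  have q_itv : 0 < q.2 < pi.
    rewrite !lt_neqAle q0 qpi !andbT; apply/andP; split.
      by apply: contra s0 => /eqP <-; rewrite sin0.
    by apply: contra s0 => /eqP ->; rewrite sinpi.
  have := @cvg_acos_quotient R q.1 q.2 q_itv.
  move=> /cvg_at_rightP/(_ u (conj u0 cu)) lim.
  have : `|(acos (dot (spherical q.1 q.2) (spherical 0 (u n))) - q.2) / u n| *
      sin q.2 @[n --> \oo] --> `|- cos q.1| * sin q.2.
    by apply: cvgM; [apply: (@cvg_norm _ R); exact: lim|exact: cvg_cst].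
  rewrite normrN; apply: cvg_trans; apply: near_eq_cvg; near=> n.
  rewrite /F dot_north cosK ?in_itv/= ?q0// normrM normfV (gtr0_norm (u0 n)).
  by rewrite (distrC q.2) mulrAC.
have i1 : (leb2 R).-integrable (srect R) (EFin \o cst (1 : R)).
  apply: integrable_rect; [exact: twopi_ge0|exact: pi_ge0|].
  by move=> q; exact: cvg_cst.
have iF0 : (leb2 R).-integrable (srect R) (EFin \o F0).
  by apply: integrable_rect; [exact: twopi_ge0|exact: pi_ge0|].
have mF (G : R * R -> R) : continuous G -> measurable_fun (srect R) (EFin \o G).
  move=> cG; apply/measurable_EFinP.
  exact: measurable_funS (continuous_measurable_fun2 cG).
have aecvg : {ae leb2 R, forall q, srect R q ->
    (EFin \o F (u n)) q @[n --> \oo] --> (EFin \o F0) q}.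
  by apply: aeW => q Dq; apply: cvg_EFin; [exact: nearW|exact: ptw].
have aedom : {ae leb2 R, forall q n, srect R q ->
    (`|(EFin \o F (u n)) q| <= (EFin \o cst (1%R : R)) q)%E}.
  by apply: aeW => q n Dq; rewrite lee_fin; exact: dom.
have [_ _ lim] := @dominated_convergence _ _ _ (leb2 R) (srect R) mD
  (fun n => EFin \o F (u n)) (EFin \o F0) (EFin \o cst (1 : R))
  (fun n => mF _ (cF (u n))) (mF _ cF0) aecvg i1 aedom.
under eq_fun do rewrite FE.
rewrite -(Rintegral_abs_cos_sin R).
apply: fine_cvg; move: lim; rewrite /Rintegral fineK//.
by apply: (integrable_fin_num _ iF0); exact: measurable_rect.
Unshelve. all: by end_near. Qed.

(** The constant 8 is 4 pi times 2 / pi, the mean of |cos t|; e absorbs both the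
    error in the limit of [cvg_arc_integral] and the ratio of arc to chord. *)
Lemma arc_bound (R : realType) (e : R) : 0 < e ->
  exists2 d0 : R, 0 < d0 & forall y z, sphere y -> sphere z ->
    acos (dot y z) < d0 ->
    sphere_integral (fun x => `|acos (dot x y) - acos (dot x z)|) <=
    (8 + e) * enorm (y - z).
Proof.
move=> e0; have e20 : 0 < e / 2 by lra.
have /(@cvgrPdist_lt _ R^o)/(_ _ e20) := @cvg_arc_integral R.
rewrite /at_right near_withinE => /nbhs_ballP[r /= r0 hr].
(* d <= chord (1 + d), and (8 + e / 2) (1 + d) <= 8 + e for small d. *)
pose d0 := Num.min r (Num.min 1 (e / (2 * (8 + e)))).
have d00 : 0 < d0.
  by rewrite !lt_min r0 ltr01 divr_gt0// mulr_gt0//; lra.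
exists d0 => // y z Sy Sz; rewrite sphere_integral_acos_sub//.
have /andP[a0 api] := acos_dot_itv Sy Sz; have cub := acos_sub_cubic_le Sy Sz.
set a := acos _ in a0 api cub *; rewrite !lt_min => /and3P[ar a1 ae].
have chord0 := enorm_ge0 (y - z).
have [a00|an0] := eqVneq a 0.
  rewrite a00; apply: (@le_trans _ _ 0); last by rewrite mulr_ge0//; lra.
  rewrite le_eqVlt; apply/orP; left; apply/eqP.
  transitivity (@sphere_integral R (fun=> 0)).
    by apply: eq_sphere_integral => x _; rewrite subrr normr0.
  by rewrite sphere_integral_cst mulr0.
have agt0 : 0 < a by rewrite lt0r an0.
have := hr a; rewrite /ball/= sub0r normrN (ger0_norm a0) => /(_ ar agt0).
rewrite ltr_norml => /andP[lo _].
have {}lo : arc_integral a <= (8 + e / 2) * a.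
  by rewrite -ler_pdivrMr//; lra.
move: ae; rewrite ltr_pdivlMr ?mulr_gt0//; last by lra.
move=> ae; apply: le_trans lo _.
have ac : a <= enorm (y - z) * (1 + a).
  have h : a * (1 - a ^+ 2 / 24) <= enorm (y - z).
    by apply: le_trans cub; rewrite -subr_ge0 (_ : _ - _ = 0)//; field.
  have : a <= a * (1 - a ^+ 2 / 24) * (1 + a).
    rewrite -mulrA ler_peMr//; nra.
  by move=> h'; apply: le_trans h' _; rewrite ler_wpM2r//; lra.
apply: (@le_trans _ _ ((8 + e / 2) * (enorm (y - z) * (1 + a)))).
  by rewrite ler_wpM2l//; lra.
rewrite mulrCA mulrC ler_wpM2r//.
nra.
Qed.

(** * Variation of closed sequences *)

Section variation.
Variables (R : realType) (n : nat) (k : nat -> R).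

Definition variation : R := \sum_(0 <= i < n) `|k i.+1 - k i|.

Let variation_ge i j : (i <= j)%N ->
  `|k j - k i| <= \sum_(i <= l < j) `|k l.+1 - k l|.
Proof.
move=> ij; rewrite -(telescope_sumr k ij); exact: ler_norm_sum.
Qed.

Hypothesis closed : k 0 = k n.

(** A closed subsequence has no larger variation, and the increments of the one
    through i1, i2, i3, i4, taken with alternating signs, add up to twice the
    alternating sum. *)
Lemma variation4 i1 i2 i3 i4 : (i1 <= i2 <= i3)%N -> (i3 <= i4 <= n)%N ->
  2 * `|k i1 - k i2 + k i3 - k i4| <= variation.
Proof.
move=> /andP[i12 i23] /andP[i34 i4n].
have [i2n i3n] := (leq_trans i23 (leq_trans i34 i4n), leq_trans i34 i4n).
have i1n := leq_trans i12 i2n.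
rewrite /variation (big_cat_nat (n := i1))//=.
rewrite (big_cat_nat (m := i1) (n := i2))//=.
rewrite (big_cat_nat (m := i2) (n := i3))//=.
rewrite (big_cat_nat (m := i3) (n := i4))//=.
have := variation_ge (leq0n i1); have := variation_ge i12.
have := variation_ge i23; have := variation_ge i34; have := variation_ge i4n.
rewrite !ler_norml closed.
have [h|h] := ger0P (k i1 - k i2 + k i3 - k i4); lra.
Qed.

(** If k is high at i1 and i3 and low at i2 and i4, one of the high indices can
    be moved to a maximum and one of the low indices to a minimum, keeping the
    cyclic alternation; hence the gap p - q adds to twice the oscillation. *)
Lemma variation_gap i1 i2 i3 i4 iM im p q :
  (i1 <= i2 <= i3)%N -> (i3 <= i4 <= n)%N -> (iM <= n)%N -> (im <= n)%N ->
  p <= k i1 -> p <= k i3 -> k i2 <= q -> k i4 <= q -> q <= p ->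
  2 * (k iM - k im) + 2 * (p - q) <= variation.
Proof.
move=> /andP[i12 i23] /andP[i34 i4n] Mn mn p1 p3 q2 q4 qp.
have A a b c d : (a <= b)%N -> (b <= c)%N -> (c <= d)%N -> (d <= n)%N ->
    2 * (k a - k b + k c - k d) <= variation.
  move=> ab bc cd dn; have := @variation4 a b c d; rewrite ab bc cd dn.
  by move=> /(_ isT isT); have := ler_norm (k a - k b + k c - k d); lra.
have B a b c d : (a <= b)%N -> (b <= c)%N -> (c <= d)%N -> (d <= n)%N ->
    2 * (k b - k a + k d - k c) <= variation.
  move=> ab bc cd dn; have := @variation4 a b c d; rewrite ab bc cd dn.
  move=> /(_ isT isT); have := ler_norm (- (k a - k b + k c - k d)).
  by rewrite normrN; lra.
have i24 := leq_trans i23 i34; have i13 := leq_trans i12 i23.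
have [M2|/ltnW M2] := leqP iM i2.
  have [mM|/ltnW mM] := leqP im iM.
    have := B im iM i2 i3 mM M2 i23 (leq_trans i34 i4n); lra.
  have [m3|/ltnW m3] := leqP im i3.
    have := A iM im i3 i4 mM m3 i34 i4n; lra.
  have := A iM i2 i3 im M2 i23 m3 mn; lra.
have [M4|/ltnW M4] := leqP iM i4.
  have [m1|/ltnW m1] := leqP im i1.
    have := B im i1 i2 iM m1 i12 M2 Mn; lra.
  have [mM|/ltnW mM] := leqP im iM.
    have := A i1 im iM i4 m1 mM M4 i4n; lra.
  have := A i1 i2 iM im i12 M2 mM mn; lra.
have [m3|/ltnW m3] := leqP im i3.
  have [m2|/ltnW m2] := leqP im i2.
    have := B im i3 i4 iM m3 i34 M4 Mn; lra.
  have := B im i3 i4 iM m3 i34 M4 Mn; lra.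
have [mM|/ltnW mM] := leqP im iM.
  have := B i2 i3 im iM i23 m3 mM Mn; lra.
have := A i3 i4 iM im i34 M4 mM mn; lra.
Qed.

Lemma variation_oscillation iM im : (iM <= n)%N -> (im <= n)%N ->
  2 * (k iM - k im) <= variation.
Proof.
move=> Mn mn; have [Mm|/ltnW mM] := leqP iM im.
  have := @variation4 iM im im im; rewrite Mm leqnn mn => /(_ isT isT).
  by have := ler_norm (k iM - k im + k im - k im); lra.
have := @variation4 im iM iM iM; rewrite mM leqnn Mn => /(_ isT isT).
have := ler_norm (- (k im - k iM + k iM - k iM)); rewrite normrN; lra.
Qed.

End variation.

(** * Closed curves and their inscribed polygons *)

Section dist_to.
Variables (R : realType) (g : R -> 'rV[R]_3).
Hypothesis Sg : forall t : R, t \in `[0, 1] -> sphere (g t).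
Implicit Types x y : 'rV[R]_3.

Let C := curve_image g.

Let C0 x : [set geodist x y | y in C] !=set0.
Proof. by exists (geodist x (g 0)), (g 0) => //; exists 0; rewrite //= in_itv/= lexx ler01. Qed.

Let C_lb x : sphere x -> has_lbound [set geodist x y | y in C].
Proof.
move=> Sx; exists 0 => _ [_ [t t01 <-] <-].
by have /andP[] := acos_dot_itv Sx (Sg t01).
Qed.

Lemma dist_to_le x t : sphere x -> t \in `[0, 1] ->
  dist_to x C <= acos (dot x (g t)).
Proof.
by move=> Sx t01; apply: ge_inf; [exact: C_lb|exists (g t) => //; exists t].
Qed.

Lemma dist_to_ge x m : (forall t, t \in `[0, 1] -> m <= acos (dot x (g t))) ->
  m <= dist_to x C.
Proof. by move=> h; apply: lb_le_inf => // _ [_ [t t01 <-] <-]; exact: h. Qed.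

Lemma scont_dist_to : scont (fun x => dist_to x C).
Proof.
apply: scont_lipschitz => x y Sx Sy.
have h x' y' : sphere x' -> sphere y' -> dist_to x' C - acos (dot x' y') <= dist_to y' C.
  move=> Sx' Sy'; apply: dist_to_ge => t t01.
  have := geodesic_triangle (Sg t01) Sx' Sy'.
  rewrite (dotC _ x') (dotC _ y') ler_norml.
  by have := dist_to_le Sx' t01; lra.
by have := h _ _ Sx Sy; have := h _ _ Sy Sx; rewrite (dotC y x) ler_norml; lra.
Qed.

End dist_to.

Lemma within_continuous_dot (R : realType) (g : R -> 'rV[R]_3) (y : 'rV[R]_3) :
  {within `[0, 1], continuous g} ->
  {within `[0, 1], continuous (fun t => dot (g t) y)}.
Proof.
move=> cg; apply/subspace_continuousP => t0 t01 /=.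
rewrite /from_subspace dotE; under eq_fun do rewrite dotE.
have /subspace_continuousP/(_ _ t01) cgt := cg.
have coord j : g s ord0 j @[s --> within `[0, 1] (nbhs t0)] --> g t0 ord0 j.
  exact: (cvg_comp _ _ cgt (@coord_continuous R 1 3 ord0 j (g t0))).
have coordM j : g s ord0 j * y ord0 j @[s --> within `[0, 1] (nbhs t0)]
    --> g t0 ord0 j * y ord0 j.
  by apply: cvgM; [exact: coord|exact: cvg_cst].
by apply: cvgD; first apply: cvgD; exact: coordM.
Qed.

Lemma closed_curve_uniform (R : realType) (g : R -> 'rV[R]_3) (e : R) :
  closed_curve g -> 0 < e -> exists2 r, 0 < r &
  forall s t : R, s \in `[0, 1] -> t \in `[0, 1] -> `|s - t| < r ->
    acos (dot (g s) (g t)) < e.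
Proof.
move=> [cg Sg _] e0.
have e20 : 0 < e / 2 by lra.
pose P (r t : R) := t \in `[0, 1] -> forall s : R, s \in `[0, 1] -> `|s - t| < r ->
  acos (dot (g s) (g t)) < e.
have cpt := @segment_compact R 0 1.
have /compact_near_coveringP/(_ R (0^'+) P) := cpt.
case.
  move=> t0 /= t01; have St0 := Sg _ t01.
  have cdot : dot (g s) (g t0) @[s --> within `[0, 1] (nbhs t0)] --> (1 : R).
    have /subspace_continuousP/(_ _ t01) := @within_continuous_dot R g (g t0) cg.
    by rewrite /from_subspace; move/sphereE : (St0) => ->.
  pose d := (e / 2) ^+ 2 / 18.
  have d0 : 0 < d by rewrite divr_gt0// exprn_gt0.
  have /(@cvgrPdist_lt _ R^o)/(_ d d0) := cdot.
  rewrite near_withinE => /nbhs_ballP[r /= r0 hr].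
  have near_t0 s : s \in `[0, 1] -> `|s - t0| < r -> acos (dot (g s) (g t0)) < e / 2.
    move=> s01 st; have Ss := Sg _ s01.
    have k1 := norm_dot_le1 Ss St0.
    have l1 : `|1 : R| <= 1 by rewrite normr1.
    have := acos_dist k1 l1; rewrite acos1 subr0.
    have /andP[a0 _] := acos_itv k1; rewrite ger0_norm// => /le_lt_trans; apply.
    have -> : e / 2 = Num.sqrt (18 * d).
      rewrite (_ : 18 * d = (e / 2) ^+ 2); last by rewrite /d; field.
      by rewrite sqrtr_sqr gtr0_norm.
    rewrite ltr_sqrt; last by rewrite mulr_gt0.
    rewrite ltr_pM2l// distrC; apply: hr => //.
    by rewrite /ball/= distrC.
  exists (ball t0 (r / 2), [set r' : R | r' < r / 2]).
    split => /=; first by apply: nbhsx_ballx; lra.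
    by apply: nbhs_right_lt; lra.
  move=> [t r'] /= []; rewrite /ball/= => tt0 r'r t01' s s01 st.
  have St := Sg _ t01'; have Ss := Sg _ s01.
  have ht : acos (dot (g t) (g t0)) < e / 2.
    by apply: near_t0 => //; rewrite distrC; lra.
  have hs : acos (dot (g s) (g t0)) < e / 2.
    apply: near_t0 => //; have -> : s - t0 = (s - t) + (t - t0) by ring.
    by apply: le_lt_trans (ler_normD _ _) _; rewrite (distrC t); lra.
  have := geodesic_triangle Ss St St0; rewrite ler_norml; lra.
move=> r /= r0 hr; have rr : 0 < r / 2 by lra.
exists (r / 2) => // s t s01 t01; apply: (hr (r / 2)) => //=.
by rewrite sub0r normrN ger0_norm; lra.
Qed.

(** * The integral of the distance to a closed curve *)

Lemma uniform_polygon_le_length (R : realType) (g : R -> 'rV[R]_3) (n : nat) :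
  (0 < n)%N ->
  ((\sum_(0 <= i < n) enorm (g (i.+1%:R / n%:R) - g (i%:R / n%:R)))%:E <=
   curve_length g)%E.
Proof.
move=> n0; have n0' : (0 : R) < n%:R by rewrite ltr0n.
pose s : seq R := mkseq (fun i => i.+1%:R / n%:R) n.
have part : itv_partition 0 1 s.
  split.
    apply/(pathP 0) => i; rewrite size_mkseq => i_n.
    have -> : nth 0 (0 :: s) i = i%:R / n%:R :> R.
      case: i i_n => [|i] i_n /=; first by rewrite mul0r.
      by rewrite nth_mkseq// ltnW.
    by rewrite nth_mkseq// ltr_pM2r ?invr_gt0// ltr_nat.
  rewrite (last_nth 0) size_mkseq.
  case: n n0 n0' @s => // m _ m0 s /=.
  by rewrite nth_mkseq// divff// gt_eqF.
have -> : \sum_(0 <= i < n) enorm (g (i.+1%:R / n%:R) - g (i%:R / n%:R)) =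
    polygon_length 0 1 g s.
  rewrite /polygon_length size_mkseq; apply: eq_big_nat => i /andP[_ i_n].
  rewrite /= nth_mkseq//; congr (enorm (_ - g _)).
  case: i i_n => [|i] i_n /=; first by rewrite mul0r.
  by rewrite nth_mkseq// ltnW.
by apply: ereal_sup_ubound; exists s.
Qed.

Lemma uniform_polygon_le (R : realType) (g : R -> 'rV[R]_3) (L : R) (n : nat) :
  (0 < n)%N -> curve_length g = L%:E ->
  \sum_(0 <= i < n) enorm (g (i.+1%:R / n%:R) - g (i%:R / n%:R)) <= L.
Proof. by move=> n0 gL; rewrite -lee_fin -gL; exact: uniform_polygon_le_length. Qed.

Lemma length_ge0 (R : realType) (g : R -> 'rV[R]_3) (L : R) :
  curve_length g = L%:E -> 0 <= L.
Proof.
move=> gL; apply: le_trans (uniform_polygon_le (n := 1) _ gL) => //.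
by rewrite big_nat1 enorm_ge0.
Qed.

(** Positive when some circle centred at x has g b and g d inside and g a and g c
    outside. *)
Definition alternation (R : realType) (g : R -> 'rV[R]_3) (a b c d : R)
    (x : 'rV[R]_3) : R :=
  Num.max 0 (Num.min (acos (dot x (g a))) (acos (dot x (g c))) -
             Num.max (acos (dot x (g b))) (acos (dot x (g d)))).

Section crofton.
Variables (R : realType) (g : R -> 'rV[R]_3) (L : R).
Hypothesis gC : closed_curve g.
Hypothesis gL : curve_length g = L%:E.
Variables a b c d : R.
Hypothesis abcd : [/\ 0 <= a, a <= b, b <= c, c <= d & d <= 1].

Let Sg (t : R) : t \in `[0, 1] -> sphere (g t).
Proof. by case: gC => _ + _; exact. Qed.

Lemma scont_alternation : scont (alternation g a b c d).
Proof.
have [a0 ab bc cd d1] := abcd.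
have sg t : 0 <= t <= 1 -> scont (fun x => acos (dot x (g t))).
  by move=> t01; apply: scont_acos; apply: Sg; rewrite in_itv.
apply: scont_max; first exact: scont_cst.
by apply: scontB; [apply: scont_min|apply: scont_max]; apply: sg; lra.
Qed.

Section mesh.
Variables (n : nat) (del : R).
Hypothesis n0 : (0 < n)%N.
Hypothesis mesh : forall s t : R, s \in `[0, 1] -> t \in `[0, 1] ->
  `|s - t| <= n%:R^-1 -> acos (dot (g s) (g t)) <= del.

Let u (i : nat) : R := i%:R / n%:R.
Let k (x : 'rV[R]_3) (i : nat) := acos (dot x (g (u i))).

Let nR : (0 : R) < n%:R. Proof. by rewrite ltr0n. Qed.

Let u01 i : (i <= n)%N -> u i \in `[0, 1].
Proof.
by move=> i_n; rewrite in_itv/= divr_ge0//= ler_pdivrMr// mul1r ler_nat.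
Qed.

Let ix (t : R) : nat := Num.truncn (t * n%:R).

Let ixP t : 0 <= t <= 1 -> [/\ (ix t <= n)%N & `|t - u (ix t)| <= n%:R^-1].
Proof.
move=> /andP[t0 t1]; have tn0 : 0 <= t * n%:R by rewrite mulr_ge0.
have /andP[lo hi] := Num.Theory.truncn_itv tn0; rewrite -/(ix t) in lo hi.
split.
  by rewrite -(ler_nat R); apply: le_trans lo _; rewrite ler_piMl.
have -> : t - u (ix t) = (t * n%:R - (ix t)%:R) / n%:R.
  by rewrite /u; field; rewrite gt_eqF.
rewrite normrM (gtr0_norm (_ : 0 < n%:R^-1)) ?invr_gt0//.
rewrite -[leRHS]mul1r ler_pM2r ?invr_gt0// ger0_norm ?subr_ge0//.
by rewrite lerBlDl -natr1 in hi *; exact: ltW.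
Qed.

Let ix_mono s t : s <= t -> (ix s <= ix t)%N.
Proof. by move=> st; apply: Num.Theory.le_truncn; rewrite ler_wpM2r. Qed.

Let k_close x t : sphere x -> 0 <= t <= 1 ->
  `|acos (dot x (g t)) - k x (ix t)| <= del.
Proof.
move=> Sx t01; have [i_n tu] := ixP t01.
have St : sphere (g t) by apply: Sg; rewrite in_itv.
apply: le_trans (geodesic_triangle Sx St (Sg (u01 i_n))) _.
by apply: mesh => //; exact: u01.
Qed.

(** The left-hand side is the oscillation of t |-> arccos <x, g t>, which closes
    up, so that it is at most half the variation; a positive alternation is a gain
    by [variation_gap], and passing to grid points costs 4 del. *)
Lemma width_le_variation x : sphere x ->
  pi - dist_to x (curve_image g) - dist_to (- x) (curve_image g) <=
  variation n (k x) / 2 + 4 * del - alternation g a b c d x.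
Proof.
move=> Sx; have [a0 ab bc cd d1] := abcd.
have closed : k x 0 = k x n.
  rewrite /k /u mul0r divff ?gt_eqF//.
  by have [_ _ ->] := gC.
have del0 : 0 <= del.
  have z01 : (0 : R) \in `[0, 1] by rewrite in_itv/= lexx ler01.
  have := mesh z01 z01; rewrite subrr normr0 invr_ge0 ltW// => /(_ isT).
  by apply: le_trans; have /andP[] := acos_dot_itv (Sg z01) (Sg z01).
have key t s : t \in `[0, 1] -> s \in `[0, 1] ->
    acos (dot x (g t)) - acos (dot x (g s)) <=
    variation n (k x) / 2 + 4 * del - alternation g a b c d x.
  rewrite !in_itv/= => t01 s01.
  have [tn _] := ixP t01; have [sn _] := ixP s01.
  have := k_close Sx t01; have := k_close Sx s01.
  rewrite !ler_norml => hs ht.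
  have osc := variation_oscillation closed tn sn.
  rewrite /alternation; set P := Num.min _ _; set Q := Num.max (acos _) _.
  have [m0|m0] := leP 0 (P - Q); last by lra.
  have [p q] : [/\ 0 <= b <= 1 & 0 <= c <= 1] by split; lra.
  have [p' q'] : [/\ 0 <= a <= 1 & 0 <= d <= 1] by split; lra.
  have := k_close Sx p; have := k_close Sx q.
  have := k_close Sx p'; have := k_close Sx q'.
  rewrite !ler_norml => hd ha hc hb.
  have [Pa Pc] : [/\ P <= acos (dot x (g a)) & P <= acos (dot x (g c))].
    by rewrite /P !ge_min !lexx orbT.
  have [Qb Qd] : [/\ acos (dot x (g b)) <= Q & acos (dot x (g d)) <= Q].
    by rewrite /Q !le_max !lexx orbT.
  have [gap|gap] := leP (Q + del) (P - del); last by lra.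
  have [dn _] := ixP q'.
  have := @variation_gap R n (k x) closed (ix a) (ix b) (ix c) (ix d)
    (ix t) (ix s) (P - del) (Q + del).
  rewrite !ix_mono// dn tn sn => /(_ isT isT isT isT).
  have [h1 h2] : P - del <= k x (ix a) /\ P - del <= k x (ix c) by split; lra.
  have [h3 h4] : k x (ix b) <= Q + del /\ k x (ix d) <= Q + del by split; lra.
  by move=> /(_ h1 h2 h3 h4 gap); lra.
set V := variation n (k x) / 2 + 4 * del - alternation g a b c d x in key *.
have h1 s : s \in `[0, 1] ->
    pi - acos (dot x (g s)) - V <= dist_to (- x) (curve_image g).
  move=> s01; apply: dist_to_ge => t t01; rewrite acos_dotN//; last exact: Sg.
  by have := key _ _ t01 s01; lra.
have h2 : pi - V - dist_to (- x) (curve_image g) <= dist_to x (curve_image g).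
  by apply: dist_to_ge => t t01; have := h1 _ t01; lra.
lra.
Qed.

(** Integration over x: x and - x contribute equally, and the variation is summed
    edge by edge over the inscribed polygon, of length at most L. *)
Lemma dist_to_mesh_ge (K : R) :
  (forall i, (i < n)%N -> sphere_integral (fun x => `|k x i.+1 - k x i|) <=
     K * enorm (g (u i.+1) - g (u i))) -> 0 <= K ->
  4 * pi ^+ 2 + sphere_integral (alternation g a b c d) -
    16 * pi * del - K * L / 2 <=
  2 * sphere_integral (fun x => dist_to x (curve_image g)).
Proof.
move=> hK K0.
have sk i : (i <= n)%N -> scont (fun x => k x i).
  by move=> i_n; apply: scont_acos; apply: Sg; exact: u01.
pose D i (x : 'rV[R]_3) := if (i < n)%N then `|k x i.+1 - k x i| else 0.
have sD i : scont (D i).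
  rewrite /D; case: ltnP => i_n; last exact: scont_cst.
  by apply: scont_norm; apply: scontB; apply: sk => //; exact: ltnW.
have varE x : variation n (k x) = \sum_(0 <= i < n) D i x.
  by apply: eq_big_nat => i /andP[_ i_n]; rewrite /D i_n.
have sd := scont_dist_to Sg; have sdN := scontN sd.
have sa := scont_alternation.
have sV := @scont_sum R n D sD.
pose lhs (x : 'rV[R]_3) := (pi - 4 * del) + alternation g a b c d x -
  2^-1 * \sum_(0 <= i < n) D i x.
pose rhs (x : 'rV[R]_3) :=
  dist_to x (curve_image g) + dist_to (- x) (curve_image g).
have le : sphere_integral lhs <= sphere_integral rhs.
  apply: le_sphere_integral.
  - apply: scontB; first by apply: scontD => //; exact: scont_cst.
    exact: scontZ.
  - exact: scontD.
  - by move=> x Sx; have := width_le_variation Sx; rewrite varE /lhs /rhs; lra.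
move: le; rewrite /rhs sphere_integralD// (sphere_integral_antipode sd).
rewrite /lhs sphere_integralB; last 2 first.
- by apply: scontD => //; exact: scont_cst.
- exact: scontZ.
rewrite sphere_integralD//; last exact: scont_cst.
rewrite sphere_integral_cst sphere_integralZ// sphere_integral_sum//.
have sumK : \sum_(0 <= i < n) sphere_integral (D i) <= K * L.
  apply: (@le_trans _ _ (\sum_(0 <= i < n) K * enorm (g (u i.+1) - g (u i)))).
    rewrite !big_nat; apply: ler_sum => i /andP[_ i_n].
    apply: le_trans (hK i i_n).
    by rewrite /D i_n.
  by rewrite -mulr_sumr ler_wpM2l// uniform_polygon_le.
lra.
Qed.

End mesh.

(** As the mesh shrinks, [arc_bound] allows the constant K to tend to 8. *)
Lemma sphere_integral_dist_to_ge :
  2 * pi ^+ 2 - 2 * L + sphere_integral (alternation g a b c d) / 2 <=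
  sphere_integral (fun x => dist_to x (curve_image g)).
Proof.
have L0 := length_ge0 gL; have p0 := @pi_ge0 R.
apply/ler_addgt0Pl => e0 e00.
pose e := e0 / (L / 4 + 8 * pi + 1).
have den0 : 0 < L / 4 + 8 * pi + 1 by lra.
have e_gt0 : 0 < e by rewrite divr_gt0.
have [d0 d00 arc] := arc_bound e_gt0.
have m0 : 0 < Num.min e d0 by rewrite lt_min e_gt0.
have [r r0 unif] := closed_curve_uniform gC m0.
pose n := (Num.truncn r^-1).+1.
have nr : n%:R^-1 < r.
  rewrite -[r]invrK ltf_pV2 ?posrE ?invr_gt0 ?ltr0n//.
  exact: Num.Theory.truncnS_gt.
have mesh s t : s \in `[0, 1] -> t \in `[0, 1] -> `|s - t| <= n%:R^-1 ->
    acos (dot (g s) (g t)) < Num.min e d0.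
  by move=> s01 t01 st; apply: unif => //; exact: le_lt_trans nr.
have mesh_e s t : s \in `[0, 1] -> t \in `[0, 1] -> `|s - t| <= n%:R^-1 ->
    acos (dot (g s) (g t)) <= e.
  by move=> s01 t01 st; have := mesh s t s01 t01 st; rewrite lt_min => /andP[/ltW].
have n0 : (0 < n)%N by [].
have := @dist_to_mesh_ge n e n0 mesh_e (8 + e).
have nR : (0 : R) < n%:R by rewrite ltr0n.
case/(_ _ _)/wrap.
- move=> i i_n.
  have u01 j : (j <= n)%N -> (j%:R / n%:R : R) \in `[0, 1].
    by move=> j_n; rewrite in_itv/= divr_ge0//= ler_pdivrMr// mul1r ler_nat.
  have [i1 i2] := (u01 _ i_n, u01 _ (ltnW i_n)).
  apply: arc; [exact: Sg|exact: Sg|].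
  have := mesh _ _ i1 i2; rewrite lt_min => h; have /h/andP[_ //] :
      `|i.+1%:R / n%:R - i%:R / n%:R| <= (n%:R^-1 : R).
  by rewrite -mulrBl -natrB// subSnn mul1r ger0_norm// invr_ge0 ltW.
- lra.
have eE : e * (L / 4 + 8 * pi + 1) = e0.
  by rewrite /e divfK// gt_eqF.
lra.
Qed.

End crofton.

(** * Circles *)

Lemma circle_point (R : realType) (c e : 'rV[R]_3) (th : R) :
  sphere c -> sphere e -> dot c e = 0 -> 0 <= th <= pi ->
  circle c th (cos th *: c + sin th *: e).
Proof.
move=> /sphereE Sc /sphereE Se ce th_itv; split.
  apply/sphereE; rewrite dot_polar//; last exact/sphereE.
  by rewrite Se; have := cos2Dsin2 th; lra.
rewrite /geodist dotDr !dotZr ce Sc mulr0 addr0 mulr1 cosK// in_itv.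
Qed.

Lemma dist_to_circle (R : realType) (c x : 'rV[R]_3) (th : R) :
  sphere c -> 0 < th < pi -> sphere x ->
  dist_to x (circle c th) = `|acos (dot x c) - th|.
Proof.
move=> Sc th_itv Sx; have th_itv' : 0 <= th <= pi by lra.
have [e [Se ce xE]] := polar_form Sc Sx; set a := acos (dot c x) in xE.
have a_itv := acos_dot_itv Sc Sx; rewrite -/a in a_itv.
pose y := cos th *: c + sin th *: e.
have yC : circle c th y by exact: circle_point.
have xy : geodist x y = `|a - th|.
  rewrite /geodist xE dot_polar//; move/sphereE : Se => ->.
  rewrite mulr1 -cosB -cos_norm cosK// in_itv/= normr_ge0 ler_norml; lra.
rewrite (dotC x) -/a; apply/eqP; rewrite eq_le; apply/andP; split.
  rewrite -xy; apply: ge_inf; last by exists y.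
  exists 0 => _ [z [Sz _] <-]; by have /andP[] := acos_dot_itv Sx Sz.
apply: lb_le_inf; first by exists (geodist x y), y.
move=> _ [z [Sz cz] <-]; rewrite /geodist in cz *.
by have := geodesic_triangle Sc Sx Sz; rewrite -/a cz.
Qed.

Lemma mean_dist_circle (R : realType) (c : 'rV[R]_3) (th : R) :
  sphere c -> 0 < th < pi -> mean_dist (circle c th) = pi / 2 - sin th.
Proof.
move=> Sc th_itv; rewrite /mean_dist.
rewrite (eq_sphere_integral (g := fun x => `|acos (dot x c) - th|)); last first.
  by move=> x Sx; exact: dist_to_circle.
have p0 := @pi_gt0 R.
rewrite sphere_integral_zonal//; move: (pi : R) p0 => q q0.
by field; rewrite gt_eqF.
Qed.

(** A vector orthogonal to both vectors of an orthonormal pair is parallel to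
    their cross product. *)
Lemma orthonormal_expansion (R : realType) (c e y : 'rV[R]_3) :
  sphere c -> sphere e -> dot c e = 0 ->
  y = dot y c *: c + dot y e *: e + dot y (cross c e) *: cross c e.
Proof.
move=> /sphereE cc /sphereE ee ce; set f := cross c e.
have ff : dot f f = 1 by rewrite /f dot_cross cc ee ce; ring.
have [cf ef] : dot c f = 0 /\ dot e f = 0.
  by rewrite /f dot_crossl dot_crossr.
set r := _ + _; apply/eqP; rewrite -subr_eq0; apply/eqP.
set v := y - r; have vE : v = y - r by [].
have vc : dot v c = 0.
  by rewrite vE /r !dot_lin (dotC e c) (dotC f c) cc ce cf; ring.
have ve : dot v e = 0.
  by rewrite vE /r !dot_lin (dotC f e) ee ce ef; ring.
have vf : dot v f = 0.
  by rewrite vE /r !dot_lin ff cf ef; ring.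
have vxf : cross v f = dot v e *: c - dot v c *: e.
  exact: cross_cross.
have := dot_cross v f; rewrite vxf vc ve !scale0r subrr dot0r ff vf.
by move=> h; apply: dot_eq0; lra.
Qed.

Section parametrization.
Variables (R : realType) (c e : 'rV[R]_3) (th : R).
Hypotheses (Sc : sphere c) (Se : sphere e) (ce : dot c e = 0).
Hypothesis th_itv : 0 < th < pi.

Let f := cross c e.
Let dir (t : R) := cos t *: e + sin t *: f.

Definition circle_param (t : R) : 'rV[R]_3 :=
  cos th *: c + sin th *: dir (2 * pi * t).

Let sin0 : 0 < sin th. Proof. exact: sin_gt0_pi. Qed.

Let cc : dot c c = 1. Proof. exact/sphereE. Qed.
Let ee : dot e e = 1. Proof. exact/sphereE. Qed.
Let ff : dot f f = 1. Proof. by rewrite /f dot_cross cc ee ce; ring. Qed.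
Let cf : dot c f = 0. Proof. exact: dot_crossl. Qed.
Let ef : dot e f = 0. Proof. exact: dot_crossr. Qed.

Let dot_dir s t : dot (dir s) (dir t) = cos (s - t).
Proof. by rewrite /dir !dot_lin (dotC f e) ee ff ef cosB; ring. Qed.

Let sphere_dir t : sphere (dir t).
Proof. by apply/sphereE; rewrite dot_dir subrr cos0. Qed.

Let c_dir t : dot c (dir t) = 0.
Proof. by rewrite /dir !dot_lin ce cf; ring. Qed.

Lemma circle_param_circle t : circle c th (circle_param t).
Proof. by apply: circle_point => //; have := th_itv; lra. Qed.

Lemma circle_param_chord s t :
  enorm (circle_param s - circle_param t) = 2 * sin th * `|sin (pi * (s - t))|.
Proof.
rewrite /enorm.
have -> : dot (circle_param s - circle_param t) (circle_param s - circle_param t)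
    = (2 * sin th * sin (pi * (s - t))) ^+ 2.
  have -> : circle_param s - circle_param t =
      sin th *: (dir (2 * pi * s) - dir (2 * pi * t)).
    by rewrite /circle_param opprD addrACA subrr add0r scalerBr.
  have dotBB (u v : 'rV[R]_3) : dot (u - v) (u - v) = dot u u - 2 * dot u v + dot v v.
    by rewrite !dot_lin (dotC v u); ring.
  rewrite dotZl dotZr dotBB !dot_dir !subrr cos0.
  have -> : 2 * pi * s - 2 * pi * t = pi * (s - t) + pi * (s - t) by ring.
  rewrite cosD; have := cos2Dsin2 (pi * (s - t)).
  set u := cos _; set v := sin (pi * _) => uv.
  have -> : u * u = 1 - v ^+ 2 by lra.
  by ring.
by rewrite sqrtr_sqr normrM gtr0_norm// mulr_gt0.
Qed.

Lemma closed_curve_circle_param : closed_curve circle_param.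
Proof.
split.
- apply: continuous_subspaceT => t.
  have cl : {for t, continuous (fun t : R => 2 * pi * t)}.
    by apply: cvgM; [exact: cvg_cst|exact: cvg_id].
  apply: cvgD; first exact: cvg_cst.
  apply: cvgZ; first exact: cvg_cst.
  apply: cvgD; (apply: cvgZ; last exact: cvg_cst).
  + apply: (@continuous_comp _ _ _ (fun t : R => 2 * pi * t) (@cos R)) => //.
    exact: continuous_cos.
  + apply: (@continuous_comp _ _ _ (fun t : R => 2 * pi * t) (@sin R)) => //.
    exact: continuous_sin.
- by move=> t _; case: (circle_param_circle t).
- rewrite /circle_param /dir mulr0 mulr1 cos0 trigo.sin0.
  have -> : 2 * pi = 0 + pi *+ 2 :> R by ring.
  by rewrite cosD2pi sinD2pi cos0 trigo.sin0.
Qed.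

Lemma circle_param_inj : {in `[0, 1[ &, injective circle_param}.
Proof.
suff H s t : 0 <= s -> s <= t -> t < 1 -> circle_param s = circle_param t -> s = t.
  move=> s t; rewrite !in_itv/= => /andP[s0 s1] /andP[t0 t1] st.
  have [st'|/ltW st'] := leP s t; first exact: H.
  by apply/esym; exact: H.
move=> s0 st t1 E; have := circle_param_chord t s.
rewrite E subrr /enorm dot0r sqrtr0 => /esym/eqP.
rewrite mulf_eq0 normr_eq0 gt_eqF ?mulr_gt0//= => /eqP si0.
apply/eqP; rewrite eq_le st leNgt; apply/negP => st'.
have : 0 < sin (pi * (t - s)).
  have p0 := @pi_gt0 R; apply: sin_gt0_pi; rewrite mulr_gt0 ?subr_gt0//=.
  by rewrite gtr_pMr//; lra.
by rewrite si0 ltxx.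
Qed.

Lemma circle_param_image : curve_image circle_param = circle c th.
Proof.
apply/seteqP; split=> [_ [t _ <-]|y [Sy cy]]; first exact: circle_param_circle.
have [e' [Se' ce' yE]] := polar_form Sc Sy.
have := orthonormal_expansion e' Sc Se ce.
rewrite (dotC e' c) ce' scale0r add0r -/f => e'E.
have ab : dot e' e ^+ 2 + dot e' f ^+ 2 = 1.
  have /sphereE := Se'; rewrite {1 2}e'E !dot_lin (dotC f e) ee ff ef; lra.
have [t [t_itv ct st]] := exists_angle ab.
have p0 := @pi_gt0 R.
exists (t / (2 * pi)).
  rewrite /= in_itv/=; move/andP : t_itv => [t0 tpi].
  have pp0 : 0 < 2 * pi :> R by rewrite mulr_gt0.
  by rewrite divr_ge0 ?(ltW pp0)//= ler_pdivrMr// mul1r.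
rewrite yE /circle_param; move: cy; rewrite /geodist => ->.
rewrite [2 * pi * _]mulrC divfK ?gt_eqF ?mulr_gt0//.
by rewrite [in RHS]e'E ct st.
Qed.

Lemma circle_param_length : curve_length circle_param = (2 * pi * sin th)%:E.
Proof.
have p0 := @pi_gt0 R.
apply/eqP; rewrite eq_le; apply/andP; split.
  apply: ge_ereal_sup => _ [s [path_s /eqP last_s] <-]; rewrite lee_fin.
  rewrite /polygon_length.
  have -> : 2 * pi * sin th = \sum_(0 <= n < size s)
      2 * pi * sin th * (nth 1 (0 :: s) n.+1 - nth 1 (0 :: s) n).
    rewrite -mulr_sumr telescope_sumr// [nth _ _ 0]/= subr0.
    by rewrite -[size s]/(size (0 :: s)).-1 nth_last/= last_s mulr1.
  rewrite !big_nat; apply: ler_sum => i /andP[_ i_s].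
  have := (pathP 1 path_s) i i_s; rewrite -[nth 1 s i]/(nth 1 (0 :: s) i.+1) => lt_i.
  rewrite /comp circle_param_chord; set d := _ - _.
  have d0 : 0 <= pi * d by rewrite mulr_ge0 ?ltW// subr_gt0.
  have -> : 2 * pi * sin th * d = 2 * sin th * (pi * d) by ring.
  apply: ler_wpM2l; first by rewrite mulr_ge0// ltW.
  rewrite ler_norml sin_le_id// andbT.
  have [dpi|dpi] := leP (pi * d) pi.
    by apply: (@le_trans _ _ 0); [lra|apply: sin_ge0_pi; rewrite d0].
  by apply: (@le_trans _ _ (-1)); [have := @pi_ge2 R; lra|exact: sin_geN1].
apply/lee_addgt0Pr => k k0.
pose K := 2 * sin th * (pi ^+ 3 / 6).
have K0 : 0 < K by rewrite !mulr_gt0// exprn_gt0.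
pose n := (Num.truncn (K / k)).+1.
have n1 : (1 : R) <= n%:R by rewrite ler1n.
have nK : K < k * n%:R.
  by rewrite mulrC -ltr_pdivrMr//; exact: Num.Theory.truncnS_gt.
have nR : (0 : R) < n%:R by lra.
have := @uniform_polygon_le_length R circle_param n isT.
rewrite (eq_bigr (fun=> 2 * sin th * `|sin (pi / n%:R)|)); last first.
  move=> i _; rewrite circle_param_chord -natr1; congr (_ * `|sin _|).
  by move: (pi : R) => q; field; rewrite gt_eqF.
rewrite sumr_const_nat subn0 -[_ *+ n]mulr_natr => len.
apply: (@le_trans _ _ ((2 * sin th * `|sin (pi / n%:R)| * n%:R)%:E + k%:E)%E);
  last by rewrite leeD.
rewrite -EFinD lee_fin.
have pn0 : 0 <= pi / n%:R :> R by rewrite divr_ge0 ?(ltW p0) ?(ltW nR).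
have cub : pi / n%:R - (pi / n%:R) ^+ 3 / 6 <= `|sin (pi / n%:R)| :> R.
  by apply: le_trans (sin_ge_cubic pn0) _; exact: ler_norm.
have h : 2 * sin th * (pi / n%:R - (pi / n%:R) ^+ 3 / 6) * n%:R =
    2 * pi * sin th - K / n%:R ^+ 2.
  by rewrite /K; move: (pi : R) (sin th) => q v; field; rewrite gt_eqF.
have : 2 * pi * sin th - K / n%:R ^+ 2 <= 2 * sin th * `|sin (pi / n%:R)| * n%:R.
  by rewrite -h ler_pM2r// ler_pM2l// mulr_gt0.
have : K / n%:R ^+ 2 <= k.
  rewrite ler_pdivrMr ?exprn_gt0//; nra.
lra.
Qed.

End parametrization.

Lemma circle_simple_closed (R : realType) (C : set 'rV[R]_3) (L : R) :
  circle_of_length L C -> simple_closed_of_length L C /\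
  mean_dist C = pi / 2 - L / (2 * pi).
Proof.
move=> [c [th [Sc th_itv <- ->]]]; have [e [Se ce]] := exists_orthogonal c.
split.
  exists (circle_param c e th); split.
  - by split; [exact: closed_curve_circle_param|exact: circle_param_inj].
  - exact: circle_param_length.
  - by rewrite circle_param_image.
rewrite mean_dist_circle//; congr (_ - _); have := @pi_gt0 R.
by move: (pi : R) => q q0; field; rewrite gt_eqF.
Qed.

(** * Curves without alternation *)

(** On a small rectangle around x0 the integrand is at least f x0 / 2 times the
    area density. *)
Lemma sphere_integral_gt0 (R : realType) (f : 'rV[R]_3 -> R) (x0 : 'rV[R]_3) :
  scont f -> (forall x, sphere x -> 0 <= f x) -> sphere x0 -> 0 < f x0 ->
  0 < sphere_integral f.
Proof.
move=> cf f0 Sx0 fx0; have [t0 [p0 [t0_itv p0_itv x0E]]] := spherical_surj Sx0.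
have pi0 := @pi_gt0 R.
pose m := f x0 / 2; have m0 : 0 < m by rewrite /m; lra.
have := cf (t0, p0); rewrite /continuous_at -x0E => /(@cvgrPdist_lt _ R^o)/(_ m m0).
move=> /nbhs_ballP[r /= r0 hr].
pose t1 := Num.max 0 (t0 - r / 2); pose t2 := Num.min (2 * pi) (t0 + r / 2).
pose p1 := Num.max 0 (p0 - r / 2); pose p2 := Num.min pi (p0 + r / 2).
have t1P : [/\ 0 <= t1, t0 - r / 2 <= t1 & t1 <= t0].
  by rewrite /t1 !le_max !lexx orbT; split=> //; rewrite ge_max; lra.
have t2P : [/\ t2 <= 2 * pi, t2 <= t0 + r / 2 & t0 <= t2].
  by rewrite /t2 !ge_min !lexx orbT; split=> //; rewrite le_min; lra.
have p1P : [/\ 0 <= p1, p0 - r / 2 <= p1 & p1 <= p0].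
  by rewrite /p1 !le_max !lexx orbT; split=> //; rewrite ge_max; lra.
have p2P : [/\ p2 <= pi, p2 <= p0 + r / 2 & p0 <= p2].
  by rewrite /p2 !ge_min !lexx orbT; split=> //; rewrite le_min; lra.
have t12 : t1 < t2 by rewrite gt_max !lt_min; lra.
have p12 : p1 < p2 by rewrite gt_max !lt_min; lra.
move: t1P t2P p1P p2P => [t1a t1b t1c] [t2a t2b t2c] [p1a p1b p1c] [p2a p2b p2c].
pose B := rect t1 t2 p1 p2.
have BD : B `<=` srect R.
  by move=> [t p] []; rewrite /= !in_itv/= => tB pB; split; rewrite /= in_itv/=; lra.
have fB q : B q -> m * sin q.2 <= f (spherical q.1 q.2) * sin q.2.
  move: q => [t p] Btp; have [_ /=] := BD _ Btp; rewrite in_itv/= => p_itv.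
  apply: ler_wpM2r; first exact: sin_ge0_pi.
  have : ball (t0, p0) r (t, p).
    case: Btp; rewrite /= !in_itv/= => tB pB.
    by split; rewrite /ball/= ltr_norml; lra.
  by move=> /hr /=; rewrite ltr_norml /m; lra.
have cs : continuous (fun q : R * R => m * sin q.2).
  by move=> q; apply: cvgM; [exact: cvg_cst|exact: continuous_sin2].
have cF := scont_integrand cf.
have intB : \int[leb2 R]_(q in B) (m * sin q.2) =
    m * (cos p1 - cos p2) * (t2 - t1).
  rewrite (Rintegral_rect (ltW t12) (ltW p12) cs).
  have D (p : R) : is_derive p (1 : R) (fun p => - m * cos p) (m * sin p).
    by apply: is_derive_eq; rewrite /GRing.scale/=; ring.
  have cm : continuous (fun p : R => m * sin p).
    by move=> p; apply: cvgM; [exact: cvg_cst|exact: continuous_sin].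
  have cst_c : continuous (fun t : R => m * (cos p1 - cos p2)).
    by move=> t; exact: cvg_cst.
  have D' (t : R) : is_derive t (1 : R) (fun t => m * (cos p1 - cos p2) * t)
      (m * (cos p1 - cos p2)).
    by apply: is_derive_eq; rewrite /GRing.scale/=; ring.
  rewrite (Rintegral_FTC2_on t12 cst_c D'); first by ring.
  by move=> t _; rewrite (Rintegral_FTC2_on p12 cm D)//; ring.
have pos : 0 < \int[leb2 R]_(q in B) (m * sin q.2).
  rewrite intB mulr_gt0 ?subr_gt0// mulr_gt0// subr_gt0 ltr_cos// in_itv/=; lra.
have le1 : \int[leb2 R]_(q in B) (m * sin q.2) <=
    \int[leb2 R]_(q in B) (f (spherical q.1 q.2) * sin q.2).
  apply: le_Rintegral => //.
  - exact: measurable_rect.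
  - by apply: integrable_rect => //; exact: ltW.
  - by apply: integrable_rect => //; exact: ltW.
apply: lt_le_trans pos (le_trans le1 _).
have iB : (leb2 R).-integrable B
    (EFin \o (fun q : R * R => f (spherical q.1 q.2) * sin q.2)).
  by apply: integrable_rect => //; exact: ltW.
have iD := scont_integrable cf.
rewrite sphere_integralE /Rintegral; apply: fine_le.
- by apply: (integrable_fin_num _ iB); exact: measurable_rect.
- by apply: (integrable_fin_num _ iD); exact: measurable_rect.
apply: ge0_subset_integral => //.
- exact: measurable_rect.
- exact: measurable_rect.
- apply/measurable_EFinP; exact: measurable_funS (continuous_measurable_fun2 cF).
- move=> [t p] [_ /=]; rewrite in_itv/= => p_itv.
  by rewrite lee_fin mulr_ge0 ?sin_ge0_pi// f0//; exact: sphere_spherical.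
Qed.

Definition triple (R : realType) (x y z : 'rV[R]_3) : R := dot x (cross y z).

Lemma tripleC (R : realType) (x y z : 'rV[R]_3) : triple x y z = triple y z x.
Proof. by rewrite /triple /cross !dotE !vec3E; ring. Qed.

Lemma triple_swap (R : realType) (x y z : 'rV[R]_3) : triple x y z = - triple y x z.
Proof. by rewrite /triple /cross !dotE !vec3E; ring. Qed.

Section coplanar.
Variables (R : realType) (g : R -> 'rV[R]_3).
Hypothesis Sg : forall t : R, t \in `[0, 1] -> sphere (g t).
Hypothesis alt0 : forall (a b c d : R) x,
  [/\ 0 <= a, a <= b, b <= c, c <= d & d <= 1] -> sphere x ->
  alternation g a b c d x <= 0.

(** The unit normal of a separating plane would have positive alternation. *)
Lemma no_separation (a b c d k : R) v :
  [/\ 0 <= a, a <= b, b <= c, c <= d & d <= 1] ->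
  ~ [/\ dot v (g a) < k, dot v (g c) < k, k < dot v (g b) & k < dot v (g d)].
Proof.
move=> abcd [va vc vb vd]; have [a0 ab bc cd d1] := abcd.
have v0 : v != 0.
  apply/eqP => v0; move: va vb; rewrite v0 !(dotC 0) !dot0r; lra.
have Sx := sphere_normalize v0; have ev := enorm_gt0 v0.
have := alt0 abcd Sx; apply/negP; rewrite -ltNge.
have S t : 0 <= t <= 1 -> sphere (g t) by move=> t01; apply: Sg; rewrite in_itv.
have acos_lt s t : 0 <= s <= 1 -> 0 <= t <= 1 -> dot v (g s) < dot v (g t) ->
    acos (dot ((enorm v)^-1 *: v) (g t)) < acos (dot ((enorm v)^-1 *: v) (g s)).
  move=> s01 t01 st; rewrite acos_lt_acos; [|by apply: norm_dot_le1 => //; exact: S..].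
  by rewrite !dotZl ltr_pM2l ?invr_gt0.
rewrite /alternation lt_max subr_gt0; apply/orP; right.
by rewrite lt_min !gt_max !acos_lt//; lra.
Qed.

(** An affine function takes prescribed values at four affinely independent
    points, so these could be separated in any way by a plane. *)
Lemma coplanar4 (a b c d : R) :
  [/\ 0 <= a, a <= b, b <= c, c <= d & d <= 1] ->
  triple (g b - g a) (g c - g a) (g d - g a) = 0.
Proof.
move=> abcd; apply/eqP/negPn/negP => T0.
set u := g b - g a in T0; set w := g c - g a in T0; set z := g d - g a in T0.
(* v is orthogonal to w and has inner product 1 with u and with z. *)
pose Ti : R := (triple u w z)^-1.
have TiT : Ti * triple u w z = 1 by rewrite mulVf.
pose v := Ti *: (cross w z + cross u w).
have vu : dot v u = 1.
  rewrite /v dotZl dotDl (dotC (cross u w)) dot_crossl addr0.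
  rewrite (dotC (cross w z)) -/(triple u w z).
  exact: TiT.
have vw : dot v w = 0.
  rewrite /v dotZl dotDl (dotC (cross w z)) (dotC (cross u w)).
  by rewrite dot_crossl dot_crossr addr0 mulr0.
have vz : dot v z = 1.
  rewrite /v dotZl dotDl (dotC (cross w z)) dot_crossr add0r.
  rewrite (dotC (cross u w)) -/(triple z u w) tripleC.
  exact: TiT.
have ga t : dot v (g t) = dot v (g t - g a) + dot v (g a).
  by rewrite -dotDr subrK.
apply: (@no_separation a b c d (dot v (g a) + 1 / 2) v abcd); split.
- lra.
- by rewrite (ga c) vw; lra.
- by rewrite (ga b) vu; lra.
- by rewrite (ga d) vz; lra.
Qed.

Hypothesis inj : {in `[0, 1[ &, injective g}.

(** All points of the curve lie in the plane through three of them; these span a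
    plane because three distinct points of a sphere are not collinear. *)
Lemma curve_in_circle : exists c th,
  [/\ sphere c, 0 < th < pi & forall t, t \in `[0, 1] -> circle c th (g t)].
Proof.
have i0 : (0 : R) \in `[0, 1[ by rewrite in_itv/=; lra.
have i1 : (1 / 3 : R) \in `[0, 1[ by rewrite in_itv/=; lra.
have i2 : (2 / 3 : R) \in `[0, 1[ by rewrite in_itv/=; lra.
have sub t : t \in `[0, 1[ -> t \in `[0, (1 : R)].
  by rewrite !in_itv/= => /andP[-> /ltW].
have [SA SB SC] : [/\ sphere (g 0), sphere (g (1 / 3)) & sphere (g (2 / 3))].
  by split; apply: Sg; exact: sub.
pose u := g (1 / 3) - g 0; pose w := g (2 / 3) - g 0.
have u0 : u != 0.
  by rewrite subr_eq0; apply/eqP => /(inj i1 i0); lra.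
have w0 : w != 0.
  by rewrite subr_eq0; apply/eqP => /(inj i2 i0); lra.
have uw : u != w.
  by apply/eqP => /addIr /(inj i1 i2); lra.
have planar t : t \in `[0, 1] -> dot (cross u w) (g t - g 0) = 0.
  rewrite in_itv/= => /andP[t0 t1]; rewrite dotC -/(triple _ u w).
  have [t3|/ltW t3] := leP t (1 / 3).
    by apply: coplanar4; split; lra.
  have [t6|/ltW t6] := leP t (2 / 3).
    by rewrite triple_swap coplanar4 ?oppr0//; split; lra.
  by rewrite tripleC; apply: coplanar4; split; lra.
pose n := cross u w.
have n0 : n != 0.
  apply/eqP => n0; have := cross_cross (g 0) u w; rewrite -/n n0.
  have -> : cross (g 0) 0 = 0.
    by apply: vec3_ext; rewrite /cross !vec3E !mxE; ring.
  have half y : sphere (g 0 + y) -> dot (g 0) y = - (dot y y) / 2.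
    move=> /sphereE; rewrite !dot_lin (dotC y (g 0)).
    by move/sphereE : SA => ->; lra.
  have hu : dot (g 0) u = - (dot u u) / 2 by apply: half; rewrite addrC subrK.
  have hw : dot (g 0) w = - (dot w w) / 2 by apply: half; rewrite addrC subrK.
  rewrite hu hw => /esym/eqP; rewrite subr_eq0 => /eqP uwE.
  have [uu ww] := (dot_gt0 u0, dot_gt0 w0).
  have {}uwE : dot w w *: u = dot u u *: w.
    have := congr1 (fun y : 'rV[R]_3 => (- 2) *: y) uwE; rewrite /= !scalerA.
    have D (k : R) : - 2 * (- k / 2) = k by field.
    by rewrite !D.
  have E : dot w w = dot u u.
    have := congr1 (fun y => dot y y) uwE; rewrite /= !dotZl !dotZr => h.
    apply/eqP; rewrite -subr_eq0; apply/eqP.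
    have : dot w w * dot u u * (dot w w - dot u u) = 0 by lra.
    by move/eqP; rewrite !mulf_eq0 (gt_eqF ww) (gt_eqF uu) => /eqP.
  move: uwE; rewrite E => /(scalerI (lt0r_neq0 uu)) /eqP.
  by rewrite (negbTE uw).
have [c Sc cE] : exists2 c, sphere c & c = (enorm n)^-1 *: n.
  by eexists; [exact: sphere_normalize n0|].
have cg t : t \in `[0, 1] -> dot c (g t) = dot c (g 0).
  move=> t01; apply/eqP; rewrite -subr_eq0 -dotNr -dotDr cE dotZl.
  by rewrite planar// mulr0.
have k1 := norm_dot_le1 Sc SA; set k := dot c (g 0) in k1 cg.
have th_itv := acos_itv k1.
have chord y : sphere y -> dot (y - k *: c) (y - k *: c) =
    1 - 2 * k * dot c y + k ^+ 2.
  move=> /sphereE Sy; rewrite !dot_lin (dotC y c) Sy.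
  by move/sphereE : Sc => ->; ring.
have kk : k ^+ 2 != 1.
  apply/eqP => kk.
  have gk t : t \in `[0, 1] -> g t = k *: c.
    move=> t01; apply/eqP; rewrite -subr_eq0; apply/eqP/dot_eq0.
    by rewrite (chord _ (Sg t01)) cg//; lra.
  by move/eqP : u0; apply; rewrite /u !gk ?sub// subrr.
exists c, (acos k); split=> //.
- have /andP[h0 hpi] := th_itv; rewrite !lt_neqAle h0 hpi !andbT.
  have kE := norm_acosK k1.
  apply/andP; split; apply/negP => /eqP h; move/eqP: kk; apply.
    by rewrite -kE -h cos0 expr1n.
  by rewrite -kE h cospi sqrrN expr1n.
- by move=> t t01; split; [exact: Sg|rewrite /geodist cg].
Qed.

End coplanar.

(** Among the values at three times, the middle one is taken again between the
    other two times, on the arc of the loop that avoids the middle one. *)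
Lemma loop_not_injective (R : realType) (h : R -> R) :
  {within `[0, 1], continuous h} -> h 0 = h 1 -> ~ {in `[0, 1[ &, injective h}.
Proof.
move=> ch h01 inj.
have ivt (a b s : R) : 0 <= a -> a < b -> b <= 1 -> s \in `[0, 1[ ->
    Num.min (h a) (h b) <= h s <= Num.max (h a) (h b) -> a <= s <= b \/ (b = 1 /\ s = 0).
  move=> a0 ab b1 s01 hs.
  have cab : {within `[a, b], continuous h}.
    apply: continuous_subspaceW ch => t /=; rewrite !in_itv/= => /andP[at_ tb].
    by rewrite (le_trans a0)// (le_trans tb).
  have [t] := IVT (ltW ab) cab hs; rewrite in_itv/= => /andP[at_ tb] hts.
  have [t1|t1] := eqVneq t 1.
    right; have b1' : b = 1 by lra.
    split=> //; apply: inj => //; first by rewrite in_itv/=; lra.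
    by rewrite -hts t1.
  left; have <- : t = s; last by rewrite at_.
  apply: inj => //; rewrite in_itv/= (le_trans a0)//= lt_neqAle t1/=; lra.
have i0 : (0 : R) \in `[0, 1[ by rewrite in_itv/=; lra.
have i1 : (1 / 3 : R) \in `[0, 1[ by rewrite in_itv/=; lra.
have i2 : (2 / 3 : R) \in `[0, 1[ by rewrite in_itv/=; lra.
have P0 := @ivt (1 / 3) (2 / 3) 0 ltac:(clear; lra) ltac:(clear; lra)
  ltac:(clear; lra) i0.
have P1 := @ivt (2 / 3) 1 (1 / 3) ltac:(clear; lra) ltac:(clear; lra)
  ltac:(clear; lra) i1.
have P2 := @ivt 0 (1 / 3) (2 / 3) ltac:(clear; lra) ltac:(clear; lra)
  ltac:(clear; lra) i2.
rewrite -h01 in P1.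
have H0 : ~ (Num.min (h (1 / 3)) (h (2 / 3)) <= h 0 <= Num.max (h (1 / 3)) (h (2 / 3))).
  by move=> /P0; clear; lra.
have H1 : ~ (Num.min (h (2 / 3)) (h 0) <= h (1 / 3) <= Num.max (h (2 / 3)) (h 0)).
  by move=> /P1; clear; lra.
have H2 : ~ (Num.min (h 0) (h (1 / 3)) <= h (2 / 3) <= Num.max (h 0) (h (1 / 3))).
  by move=> /P2; clear; lra.
move: H0 H1 H2; move: (h 0) (h (1 / 3)) (h (2 / 3)) => x y z.
clear - x y z; have [xy|xy] := leP x y; have [yz|yz] := leP y z;
  have [zx|zx] := leP z x => h0 h1 h2;
  by [case: h0; lra|case: h1; lra|case: h2; lra].
Qed.

(** Stereographic projection from a point of the circle that the curve would
    miss turns it into a loop on a line, which cannot be injective. *)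
Lemma curve_fills_circle (R : realType) (g : R -> 'rV[R]_3) (c : 'rV[R]_3) (th : R) :
  simple_closed_curve g -> sphere c -> 0 < th < pi ->
  (forall t, t \in `[0, 1] -> circle c th (g t)) ->
  curve_image g = circle c th.
Proof.
move=> [[cg Sg g01] inj] Sc th_itv gc.
apply/seteqP; split=> [_ [t t01 <-]|q [Sq cq]]; first exact: gc.
apply: contrapT => nq.
have s0 : 0 < sin th by exact: sin_gt0_pi.
have [e [Se ce qE]] := polar_form Sc Sq.
move: cq; rewrite /geodist => cq; rewrite cq in qE.
set f := cross c e; set r := sin th in s0 qE.
have ee : dot e e = 1 by exact/sphereE.
have qe : dot q e = r by rewrite qE dotDl !dotZl ce ee; ring.
pose X t := dot (g t) e; pose Y t := dot (g t) f.
have gE t : t \in `[0, 1] -> g t = cos th *: c + X t *: e + Y t *: f.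
  move=> t01; have [St ct] := gc _ t01.
  rewrite [LHS](orthonormal_expansion (g t) Sc Se ce) -/f -/(X t) -/(Y t).
  rewrite (dotC _ c) -(norm_acosK (norm_dot_le1 Sc St)).
  by rewrite /geodist in ct; rewrite ct.
have XY t : t \in `[0, 1] -> X t ^+ 2 + Y t ^+ 2 = r ^+ 2.
  move=> t01; have [St _] := gc _ t01.
  have cc : dot c c = 1 by exact/sphereE.
  have ff : dot f f = 1 by rewrite /f dot_cross cc ee ce; ring.
  have [cf ef] : dot c f = 0 /\ dot e f = 0 by rewrite dot_crossl dot_crossr.
  move/sphereE : St; rewrite {1 2}(gE _ t01) !dotDl !dotDr !dotZl !dotZr.
  rewrite (dotC e c) (dotC f c) (dotC f e) cc ee ff ce cf ef.
  by have := cos2Dsin2 th; rewrite -/r => h1 h2; lra.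
have Xr t : t \in `[0, 1] -> X t < r.
  move=> t01; have XYt := XY _ t01; rewrite lt_neqAle; apply/andP; split; last by nra.
  apply/eqP => Xt; apply: nq; exists t => //.
  have Yt : Y t = 0 by apply/eqP; rewrite -sqrf_eq0; apply/eqP; rewrite -Xt in XYt; lra.
  by rewrite (gE _ t01) Xt Yt scale0r addr0 qE.
pose h t := Y t / (r - X t).
apply: (@loop_not_injective R h).
- have /subspace_continuousP cX := @within_continuous_dot R g e cg.
  have /subspace_continuousP cY := @within_continuous_dot R g f cg.
  apply/subspace_continuousP => t t01; rewrite /from_subspace /h.
  apply: cvgM; first exact: cY.
  apply: cvgV; first by rewrite gt_eqF// subr_gt0 Xr.
  by apply: cvgB; [exact: cvg_cst|exact: cX].
- by rewrite /h /X /Y g01.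
- move=> s t s01 t01 hst; apply: inj => //.
  have sub u : u \in `[0, 1[ -> u \in `[0, (1 : R)].
    by rewrite !in_itv/= => /andP[-> /ltW].
  have [s1 t1] := (sub _ s01, sub _ t01).
  have [rs rt] := (Xr _ s1, Xr _ t1); have [XYs XYt] := (XY _ s1, XY _ t1).
  have [rs0 rt0] : r - X s != 0 /\ r - X t != 0 by rewrite !gt_eqF ?subr_gt0.
  move: hst; rewrite /h => /eqP; rewrite eqr_div// => /eqP hst.
  have E : (r - X s) * (r - X t) * (2 * r * (X s - X t)) = 0.
    have sq : (Y s * (r - X t)) ^+ 2 = (Y t * (r - X s)) ^+ 2 by rewrite hst.
    have Ys : Y s ^+ 2 = r ^+ 2 - X s ^+ 2 by lra.
    have Yt : Y t ^+ 2 = r ^+ 2 - X t ^+ 2 by lra.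
    by rewrite !exprMn Ys Yt in sq; lra.
  have Xst : X s = X t.
    apply/eqP; rewrite -subr_eq0; move/eqP : E.
    by rewrite !mulf_eq0 (negbTE rs0) (negbTE rt0) (gt_eqF s0) pnatr_eq0.
  have Yst : Y s = Y t.
    by move: hst; rewrite Xst; exact: mulIf.
  by rewrite (gE _ s1) (gE _ t1) Xst Yst.
Qed.

(** * The sharp bound on the mean distance and its equality case *)

Lemma alternation_ge0 (R : realType) (g : R -> 'rV[R]_3) a b c d x :
  0 <= alternation g a b c d x.
Proof. by rewrite le_max lexx. Qed.

Lemma mean_dist_ge (R : realType) (g : R -> 'rV[R]_3) (L : R) :
  closed_curve g -> curve_length g = L%:E ->
  pi / 2 - L / (2 * pi) <= mean_dist (curve_image g).
Proof.
move=> gC gL; have p0 := @pi_gt0 R.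
have abcd : [/\ 0 <= 0 :> R, 0 <= 0 :> R, 0 <= 0 :> R, 0 <= 0 :> R & 0 <= 1 :> R].
  by rewrite lexx ler01.
have := sphere_integral_dist_to_ge gC gL abcd.
have := sphere_integral_ge0 (fun x _ => alternation_ge0 g 0 0 0 0 x).
rewrite /mean_dist; move: (sphere_integral _) => A A0.
move: (sphere_integral _) => I hI.
rewrite ler_pdivlMl ?mulr_gt0//.
have -> : 4 * pi * (pi / 2 - L / (2 * pi)) = 2 * pi ^+ 2 - 2 * L.
  by move: (pi : R) p0 => q q0; field; rewrite gt_eqF.
lra.
Qed.

(** Equality leaves no room for a positive alternation. The length of the circle
    so obtained is read off from its mean distance. *)
Lemma mean_dist_eq_circle (R : realType) (g : R -> 'rV[R]_3) (L : R) :
  simple_closed_curve g -> curve_length g = L%:E ->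
  mean_dist (curve_image g) = pi / 2 - L / (2 * pi) ->
  circle_of_length L (curve_image g).
Proof.
move=> simp gL E; have p0 := @pi_gt0 R; have [gC inj] := simp.
have [_ Sg _] := gC.
have I : sphere_integral (fun x => dist_to x (curve_image g)) =
    2 * pi ^+ 2 - 2 * L.
  have : 4 * pi * mean_dist (curve_image g) = 2 * pi ^+ 2 - 2 * L.
    rewrite E; move: (pi : R) p0 => q q0; by field; rewrite gt_eqF.
  by rewrite /mean_dist mulrA divff ?mul1r// gt_eqF// mulr_gt0.
have alt0 (a b c d : R) x : [/\ 0 <= a, a <= b, b <= c, c <= d & d <= 1] ->
    sphere x -> alternation g a b c d x <= 0.
  move=> abcd Sx; rewrite leNgt; apply/negP => pos.
  have := sphere_integral_gt0 (scont_alternation gC abcd)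
    (fun x _ => alternation_ge0 g a b c d x) Sx pos.
  by have := sphere_integral_dist_to_ge gC gL abcd; rewrite I; lra.
have [c [th [Sc th_itv gc]]] := curve_in_circle Sg alt0 inj.
have CE := curve_fills_circle simp Sc th_itv gc.
exists c, th; split=> //.
move: E; rewrite CE mean_dist_circle// => /addrI/oppr_inj ->.
by rewrite mulrC divfK// gt_eqF// mulr_gt0.
Qed.

Lemma exists_circle (R : realType) (L : R) : 0 < L <= 2 * pi ->
  exists C : set 'rV[R]_3, circle_of_length L C.
Proof.
move=> /andP[L0 L2]; have p0 := @pi_gt0 R; have pp0 : 0 < 2 * pi :> R by lra.
have l_itv : -1 <= L / (2 * pi) <= 1.
  rewrite ler_pdivrMr// mul1r L2 andbT.
  by apply: (@le_trans _ _ 0); [lra|rewrite divr_ge0// ltW].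
have as0 : 0 < asin (L / (2 * pi)).
  rewrite ltNge; apply/negP => h.
  have : 0 <= sin (- asin (L / (2 * pi))).
    by apply: sin_ge0_pi; have := asin_geNpi2 l_itv; lra.
  by rewrite sinN asinK ?in_itv// oppr_ge0 leNgt divr_gt0.
exists (circle (north R) (asin (L / (2 * pi)))).
exists (north R), (asin (L / (2 * pi))); split=> //; first exact: sphere_north.
  by rewrite as0/=; apply: le_lt_trans (asin_lepi2 l_itv) _; lra.
by rewrite asinK ?in_itv// mulrC divfK// gt_eqF.
Qed.

Theorem proposition1 (R : realType) :
  (forall (L : R) (g : R -> 'rV[R]_3),
     closed_curve g -> curve_length g = L%:E ->
     pi / 2 - L / (2 * pi) <= mean_dist (curve_image g)) /\
  (forall L : R, 0 < L <= 2 * pi ->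
     [/\ (forall C : set 'rV[R]_3, circle_of_length L C ->
            simple_closed_of_length L C /\
            mean_dist C = pi / 2 - L / (2 * pi)),
         (forall C : set 'rV[R]_3, simple_closed_of_length L C ->
            mean_dist C = pi / 2 - L / (2 * pi) -> circle_of_length L C)
       & inf_mean_dist L = pi / 2 - L / (2 * pi)]).
Proof.
split=> [L g gC gL|L L_itv]; first exact: mean_dist_ge.
split=> [C|_ [g [simp gL ->]]|]; first exact: circle_simple_closed.
  exact: mean_dist_eq_circle.
have [C circ] := exists_circle L_itv.
have [simp CE] := circle_simple_closed circ.
have lb : lbound [set mean_dist C | C in simple_closed_of_length L]
    (pi / 2 - L / (2 * pi)).
  by move=> _ [_ [g [[gC _] gL ->]] <-]; exact: mean_dist_ge.
rewrite /inf_mean_dist; apply/eqP; rewrite eq_le; apply/andP; split.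
  by rewrite -[leRHS]CE; apply: ge_inf; [exists (pi / 2 - L / (2 * pi))|exists C].
by apply: lb_le_inf => //; exists (mean_dist C), C.
Qed.
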